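(* Let $c\neq 0$ be a real constant. A curve $\gamma=(x,t)$ (with $x\ge 0$, lying in the $xt$-plane) is the generating curve of a rotationally invariant surface $\Sigma$ in the Heisenberg group $H_1$ with constant $p$-mean curvature $H=c$ if and only if $\gamma=(x,t)$ is given by $$x^{2}=\frac{k}{c^2}+r\cos(c\tilde s),\qquad t=-\frac{\tilde s}{c}-\frac r2\sin(c\tilde s)\quad(t\text{ up to an additive constant}),$$ for some horizontal arc-length parameter $\tilde s$ and some $k,r\in\mathbb{R}$ such that $$k\ge 1\qquad\text{and}\qquad r=\frac{2}{c^2}\sqrt{k-1}.$$ In addition, $k=2cE+2$, where $E$ is the energy of $\gamma$. If $r=0$, then $\Sigma$ is a cylinder. If $r\neq 0$, then, in terms of normal coordinates $(\bar s,\bar\theta)$, the two invariants of $\Sigma$ are $$\zeta_1(\bar\theta)=-\frac{2E\bar\theta}{cr}\ \text{ up to an additive constant (so linear in }\bar\theta),\qquad \zeta_2(\bar\theta)=-\frac{2cE+2}{c^2r}\ \text{ (a constant)}.$$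
   Context: Heisenberg group: $H_1=\mathbb{R}^3$ with product $(x_1,y_1,z_1)\circ(x_2,y_2,z_2)=(x_1+x_2,y_1+y_2,z_1+z_2+y_1x_2-x_1y_2)$. Left-invariant fields: $\mathring e_1=\partial_x+y\partial_z$, $\mathring e_2=\partial_y-x\partial_z$, $T=\partial_z$. The contact bundle $\xi$ is spanned by $\mathring e_1,\mathring e_2$ and is the kernel of $\Theta=dz+x\,dy-y\,dx$; $J:\xi\to\xi$ is $J\mathring e_1=\mathring e_2$, $J\mathring e_2=-\mathring e_1$; $\nabla$ is the connection for which $\mathring e_1,\mathring e_2,T$ are parallel; the adapted metric makes $\mathring e_1,\mathring e_2,T$ orthonormal. Surfaces: $\Sigma\subset H_1$ is of class $C^2$ and $C^\infty$ on its regular part. A point $p\in\Sigma$ is singular if $T_p\Sigma=\xi_p$ and regular otherwise. On the regular part $e_1$ is a unit vector field (unique up to sign) spanning $T\Sigma\cap\xi$, $e_2=Je_1$, the $p$-mean curvature $H$ is defined by $\nabla_{e_1}e_2=-He_1$, and the $\alpha$-function is the function such that $\alpha e_2+T$ is tangent to $\Sigma$. Set $\hat e_2=(\alpha e_2+T)/\sqrt{1+\alpha^2}$. Coordinates $(s,\theta)$ on (an open set of) the regular part are compatible if $e_1=\partial/\partial s$; then functions $a,b$ are defined by $\hat e_2=a\,\partial_s+b\,\partial_\theta$. Normal coordinates and invariants ($H=c=2\lambda\ne0$, $\alpha$ not vanishing): compatible coordinates $(s,\theta)$ are normal if $$\alpha=\lambda\frac{\sin(2\lambda s+\zeta_1(\theta))}{\zeta_2(\theta)-\cos(2\lambda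 s+\zeta_1(\theta))},\quad a=\frac{-\lambda}{\sqrt{1+\alpha^2}},\quad b=\frac{2\lambda^2}{\big(\zeta_2(\theta)-\cos(2\lambda s+\zeta_1(\theta))\big)\sqrt{1+\alpha^2}};$$ the functions $\zeta_1,\zeta_2$ are then the invariants of $\Sigma$. Rotationally invariant surfaces: the surface generated by $\gamma(s)=(x(s),0,t(s))$, $x\ge0$, $x'^2+t'^2=1$, is $\Sigma(s,\theta)=(x(s)\cos\theta,x(s)\sin\theta,t(s))$. A horizontal generating curve is $\tilde\gamma(s)=(x(s)\cos\theta(s),x(s)\sin\theta(s),t(s))$ with $\theta(s)$ chosen so that $\tilde\gamma'\in\xi$, i.e. $t'+x^2\theta'=0$. A horizontal arc-length parameter $\tilde s$ is the arc-length parameter of $\tilde\gamma$ in the adapted metric, so $\frac{d\tilde s}{ds}=\frac{\sqrt{x^2x'^2+t'^2}}{x}$. One takes $e_1=\partial/\partial\tilde s$ (tangent to the rotations of $\tilde\gamma$); with this choice $H=-\dfrac{x^3(x't''-x''t')+t'^3}{x(x^2x'^2+t'^2)^{3/2}}$. The energy is the constant $E=\dfrac{xt'}{\sqrt{x^2x'^2+t'^2}}+\lambda x^2$ with $2\lambda=c$. *)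

(* Defs.v *)
(* Stdlib reals with Coquelicot. *)
From Stdlib Require Import Reals.
From Coquelicot Require Import Coquelicot.
Open Scope R_scope.

(** * The Heisenberg group *)

(* A point of H_1, and also the (d/dx, d/dy, d/dz)-components of a tangent
   vector. *)
Definition H1 : Type := (R * R * R)%type.
Definition px (p : H1) : R := fst (fst p).
Definition py (p : H1) : R := snd (fst p).
Definition pz (p : H1) : R := snd p.

Definition heis_mul (p q : H1) : H1 :=
  (px p + px q, py p + py q, pz p + pz q + py p * px q - px p * py q).

Definition E1 (p : H1) : H1 := (1, 0, py p).
Definition E2 (p : H1) : H1 := (0, 1, - px p).
Definition T (p : H1) : H1 := (0, 0, 1).

(* a e1(p) + b e2(p) + c T(p) in the left-invariant frame. *)
Definition frame (p : H1) (a b c : R) : H1 :=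
  plus (plus (scal a (E1 p)) (scal b (E2 p))) (scal c (T p)).

(* The contact form dz + x dy - y dx. *)
Definition Theta (p v : H1) : R := pz v + px p * py v - py p * px v.

Definition horizontal (p v : H1) : Prop := Theta p v = 0.

(* The coframe dual to (E1, E2, T) is (dx, dy, Theta). *)
Lemma frame_coframe (p v : H1) : frame p (px v) (py v) (Theta p v) = v.
Proof.
destruct p as [[x y] z]; destruct v as [[a b] c].
unfold frame, plus, scal, Theta, E1, E2, T, px, py, pz; simpl.
unfold prod_plus, prod_scal, plus, scal; simpl.
unfold prod_plus, prod_scal, plus, scal, mult; simpl.
unfold mult; simpl.
f_equal; [f_equal|]; ring.
Qed.

Lemma heis_mul_frame (p : H1) (a b c : R) :
  heis_mul p (a, b, c) = plus p (frame p a b c).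
Proof.
destruct p as [[x y] z].
unfold heis_mul, frame, plus, scal, E1, E2, T, px, py, pz; simpl.
unfold prod_plus, prod_scal, plus, scal; simpl.
unfold prod_plus, prod_scal, plus, scal, mult; simpl.
unfold mult; simpl.
f_equal; [f_equal|]; ring.
Qed.

(* Norm of the adapted metric, for which E1, E2, T are orthonormal. *)
Definition hnorm (p v : H1) : R :=
  sqrt (px v ^ 2 + py v ^ 2 + Theta p v ^ 2).

(* J E1 = E2, J E2 = - E1; only applied to horizontal v. *)
Definition Jxi (p v : H1) : H1 := frame p (- py v) (px v) 0.

(** * Parametrized surfaces *)

(* A surface is given by a map X from (part of) the parameter plane to H_1.
   Vector fields on it are given by their components in the parameter plane. *)
Definition plane : Type := (R * R)%type.

Definition d1 (f : plane -> R) (p : plane) : R :=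
  Derive (fun u => f (u, snd p)) (fst p).
Definition d2 (f : plane -> R) (p : plane) : R :=
  Derive (fun v => f (fst p, v)) (snd p).

Definition dir (f : plane -> R) (p w : plane) : R :=
  fst w * d1 f p + snd w * d2 f p.

Definition dX (X : plane -> H1) (p w : plane) : H1 :=
  (dir (fun q => px (X q)) p w,
   dir (fun q => py (X q)) p w,
   dir (fun q => pz (X q)) p w).

Definition tangent (X : plane -> H1) (p : plane) (v : H1) : Prop :=
  exists w : plane, v = dX X p w.

Definition singular (X : plane -> H1) (p : plane) : Prop :=
  forall v : H1, tangent X p v <-> horizontal (X p) v.
Definition regular (X : plane -> H1) (p : plane) : Prop := ~ singular X p.

(* Covariant derivative, in the direction w, of a field V along X, for the
   connection with E1, E2, T parallel. *)
Definition nabla (X : plane -> H1) (V : plane -> H1) (p w : plane) : H1 :=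
  frame (X p)
    (dir (fun q => px (V q)) p w)
    (dir (fun q => py (V q)) p w)
    (dir (fun q => Theta (X q) (V q)) p w).

(* e holds the parameter-plane components of e_1. *)
Definition characteristic_field (U : plane -> Prop) (X : plane -> H1)
    (e : plane -> plane) : Prop :=
  forall p, U p -> regular X p ->
    horizontal (X p) (dX X p (e p)) /\ hnorm (X p) (dX X p (e p)) = 1.

Definition e2 (X : plane -> H1) (e : plane -> plane) (p : plane) : H1 :=
  Jxi (X p) (dX X p (e p)).

Definition pmean_curvature_at (X : plane -> H1) (e : plane -> plane)
    (p : plane) (H : R) : Prop :=
  nabla X (e2 X e) p (e p) = scal (- H) (dX X p (e p)).

Definition constant_pmean_curvature (U : plane -> Prop) (X : plane -> H1)
    (e : plane -> plane) (c : R) : Prop :=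
  forall p, U p -> regular X p -> pmean_curvature_at X e p c.

Definition alpha_e2_T (X : plane -> H1) (e : plane -> plane) (p : plane)
    (alpha : R) : H1 :=
  plus (scal alpha (e2 X e p)) (T (X p)).

Definition alpha_at (X : plane -> H1) (e : plane -> plane) (p : plane)
    (alpha : R) : Prop :=
  tangent X p (alpha_e2_T X e p alpha).

(** * Normal coordinates and invariants *)

Fixpoint Ck (n : nat) (W : plane -> Prop) (f : plane -> R) : Prop :=
  match n with
  | O => forall p, W p -> continuous f p
  | S m =>
      (forall p, W p ->
         ex_derive (fun u => f (u, snd p)) (fst p) /\
         ex_derive (fun v => f (fst p, v)) (snd p)) /\
      Ck m W (d1 f) /\ Ck m W (d2 f)
  end.

Definition smooth (W : plane -> Prop) (f : plane -> R) : Prop :=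
  forall n, Ck n W f.

Definition path_connected (W : plane -> Prop) : Prop :=
  forall p q, W p -> W q ->
    exists g : R -> plane,
      (forall u, continuous g u) /\ g 0 = p /\ g 1 = q /\
      forall u, 0 <= u <= 1 -> W (g u).

(* (s, th) are coordinates, with values in the plane, on the open part W of
   the surface parametrized by X on U; the last two clauses say that e_1 is
   the coordinate field d/ds. *)
Definition compatible_coordinates (U : plane -> Prop) (X : plane -> H1)
    (e : plane -> plane) (W : plane -> Prop) (s th : plane -> R) : Prop :=
  open W /\
  (forall p, W p -> U p /\ regular X p) /\
  smooth W s /\ smooth W th /\
  (forall p q, W p -> W q -> s p = s q -> th p = th q -> p = q) /\
  (forall p, W p -> d1 s p * d2 th p - d2 s p * d1 th p <> 0) /\
  (forall p, W p -> dir s p (e p) = 1) /\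
  (forall p, W p -> dir th p (e p) = 0).

(* The unit field (alpha e_2 + T) / sqrt (1 + alpha^2) is a d/ds + b d/dth:
   a and b are the derivatives of s and th along it. *)
Definition e2hat_components (X : plane -> H1) (e : plane -> plane)
    (s th : plane -> R) (p : plane) (alpha a b : R) : Prop :=
  exists w : plane,
    dX X p w = scal (/ sqrt (1 + alpha ^ 2)) (alpha_e2_T X e p alpha) /\
    dir s p w = a /\ dir th p w = b.

(* (s, th) are normal coordinates with invariants zeta1, zeta2, on a surface
   of constant p-mean curvature c = 2 lambda.  As functions of the coordinate
   th, the invariants only matter on the open set th(W). *)
Definition normal_coordinates (c : R) (U : plane -> Prop) (X : plane -> H1)
    (e : plane -> plane) (W : plane -> Prop) (s th : plane -> R)
    (zeta1 zeta2 : R -> R) : Prop :=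
  compatible_coordinates U X e W s th /\
  (forall p n, W p ->
     ex_derive_n zeta1 n (th p) /\ ex_derive_n zeta2 n (th p)) /\
  forall p, W p ->
    let lambda := c / 2 in
    let A := 2 * lambda * s p + zeta1 (th p) in
    let B := zeta2 (th p) - cos A in
    B <> 0 /\
    exists alpha a b : R,
      alpha_at X e p alpha /\ alpha <> 0 /\
      e2hat_components X e s th p alpha a b /\
      alpha = lambda * (sin A / B) /\
      a = - lambda / sqrt (1 + alpha ^ 2) /\
      b = 2 * lambda ^ 2 / (B * sqrt (1 + alpha ^ 2)).

(** * Rotationally invariant surfaces *)

Definition is_interval (dom : R -> Prop) : Prop :=
  (forall a b s, dom a -> dom b -> a <= s <= b -> dom s) /\
  exists s, interior dom s.

(* The curve s |-> (x(s), 0, t(s)), s in dom, as generating curve of a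
   rotationally invariant surface.  The interval dom may contain its
   endpoints, so that the curve may end on the axis x = 0 (at singular points
   of the surface).  At interior parameters, x <> 0 says exactly that
   (s, theta) |-> (x cos theta, x sin theta, t) is an immersion. *)
Record generating_curve (dom : R -> Prop) (x t : R -> R) : Prop := {
  gc_dom : is_interval dom;
  gc_contx : continuous_on dom x;
  gc_contt : continuous_on dom t;
  gc_nonneg : forall s, dom s -> 0 <= x s;
  gc_immersed : forall s, interior dom s -> x s <> 0;
  gc_smoothx : forall n s, interior dom s -> ex_derive_n x n s;
  gc_smootht : forall n s, interior dom s -> ex_derive_n t n s;
  gc_unit : forall s, interior dom s -> Derive x s ^ 2 + Derive t s ^ 2 = 1
}.

Definition rot_surface (x t : R -> R) (p : plane) : H1 :=
  (x (fst p) * cos (snd p), x (fst p) * sin (snd p), t (fst p)).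

Definition rot_domain (dom : R -> Prop) (p : plane) : Prop :=
  interior dom (fst p).

Definition rot_points (dom : R -> Prop) (x t : R -> R) (P : H1) : Prop :=
  exists p : plane, dom (fst p) /\ P = rot_surface x t p.

Definition velocity (g : R -> H1) (s : R) : H1 :=
  (Derive (fun u => px (g u)) s,
   Derive (fun u => py (g u)) s,
   Derive (fun u => pz (g u)) s).

Definition lifted_curve (x t th : R -> R) (s : R) : H1 :=
  rot_surface x t (s, th s).

Definition horizontal_lift (dom : R -> Prop) (x t th : R -> R) : Prop :=
  forall s, interior dom s ->
    ex_derive th s /\
    horizontal (lifted_curve x t th s) (velocity (lifted_curve x t th) s).

(* sig is an arc-length parameter of a horizontal generating curve, as a
   function of the arc-length parameter s of (x, t). *)
Definition horizontal_arclength (dom : R -> Prop) (x t sig : R -> R) : Prop :=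
  continuous_on dom sig /\
  exists th : R -> R,
    horizontal_lift dom x t th /\
    forall s, interior dom s ->
      is_derive sig s
        (hnorm (lifted_curve x t th s) (velocity (lifted_curve x t th) s)).

(* e_1 = d/d(sig): the characteristic field tangent to the rotations of the
   horizontal generating curve, in the direction of increasing s. *)
Definition rot_characteristic_field (dom : R -> Prop) (x t : R -> R)
    (e : plane -> plane) : Prop :=
  characteristic_field (rot_domain dom) (rot_surface x t) e /\
  forall p, rot_domain dom p -> 0 < fst (e p).

Definition energy (c : R) (x t : R -> R) (s : R) : R :=
  x s * Derive t s / sqrt (x s ^ 2 * Derive x s ^ 2 + Derive t s ^ 2)
  + c / 2 * x s ^ 2.

Definition is_cylinder (S : H1 -> Prop) : Prop :=
  exists (rho : R) (J : R -> Prop), 0 < rho /\ is_interval J /\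
    forall P, S P <-> px P ^ 2 + py P ^ 2 = rho ^ 2 /\ J (pz P).

Definition profile (c : R) (dom : R -> Prop) (x t sig : R -> R) (k r : R)
    : Prop :=
  horizontal_arclength dom x t sig /\
  1 <= k /\ r = 2 / c ^ 2 * sqrt (k - 1) /\
  (forall s, dom s -> x s ^ 2 = k / c ^ 2 + r * cos (c * sig s)) /\
  exists t0, forall s, dom s ->
    t s = - sig s / c - r / 2 * sin (c * sig s) + t0.

(* Main.v *)
Require Import Defs.
From Stdlib Require Import Reals Lra Lia Ranalysis5 Classical IndefiniteDescription.
From Coquelicot Require Import Coquelicot.
(* After this import d1 is a partial derivative, not the function d1 of
   Ranalysis. *)
Import Defs.
Open Scope R_scope.

(** Write D for the speed sqrt (x^2 x'^2 + t'^2) and set rad = x x' / D,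
    ang = - t' / D. In the frame (E1, E2) rotated by theta, e_1 is the unit
    vector (rad, ang), so that everything reduces to functions of the profile
    parameter: alpha = rad / x (lemma alpha_rot), E = c / 2 x^2 - x ang, and H
    is the derivative along e_1 of theta plus the polar angle of (rad, ang)
    (pmean_curvature_rot).

    If H = c, then E is constant (energy_derive). With respect to the
    horizontal arc length, whose derivative in s is D / x, the vector
    (x^2 - k / c^2, - 2 x rad / c), where k = 2 c E + 2, then rotates with
    angular velocity c, and its length is r because rad^2 + ang^2 = 1. Moreover
    x rad - c t differs from the horizontal arc length by a constant, which
    gives t. These formulas extend to the end points of the curve by
    continuity (profile_of_constant_curvature). Conversely the formulas give
    x rad and x ang, hence H = c and the energy (profile_curvature,
    profile_energy).

    Let r <> 0. The function psi = theta - (theta along the horizontal lift) is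
    constant along the characteristic curves, and s = sig - E psi,
    th = - c^2 r psi / 2 are normal coordinates, in which the phase
    A = c s + zeta1 (th) is c sig (profile_normal_coordinates).

    In arbitrary normal coordinates, let A be the phase and B = zeta2 - cos A
    the denominator. The expression of alpha gives sin A / B, and its derivative
    along e_1 then gives cos A / B, in terms of sig. Therefore (sin A, cos A) is
    +-(sin (c sig), cos (c sig)), with a sign that is constant on a path
    connected domain, and zeta2 = B + cos A is known. Since A - c sig is locally
    constant, the prescribed derivatives of s and th along alpha e_2 + T
    determine zeta1' (zeta1_derivative), and zeta1 follows up to a constant. *)

(** * Functions on intervals *)

Definition convex (I : R -> Prop) : Prop :=
  forall a b s : R, I a -> I b -> a <= s <= b -> I s.

Lemma interior_subset (D : R -> Prop) (s : R) : interior D s -> D s.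
Proof.
intros [d H]; apply H; unfold disc.
replace (s - s) with 0 by ring; rewrite Rabs_R0; apply cond_pos.
Qed.

Lemma locally_interior (D : R -> Prop) (s : R) :
  interior D s -> locally s (interior D).
Proof.
intros [d H].
assert (Hd : 0 < d / 2) by (pose proof (cond_pos d); lra).
exists (mkposreal _ Hd); intros y Hy.
exists (mkposreal _ Hd); intros z Hz.
apply H; unfold disc in *; simpl in *.
replace (z - s) with ((z - y) + (y - s)) by ring.
apply Rle_lt_trans with (1 := Rabs_triang _ _).
change (Rabs (y - s) < d / 2) in Hy; lra.
Qed.

Lemma interior_convex (D : R -> Prop) : convex D -> convex (interior D).
Proof.
intros HD a b s [da Ha] [db Hb] Hs.
assert (Hd : 0 < Rmin da db) by (apply Rmin_pos; apply cond_pos).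
exists (mkposreal _ Hd); intros y Hy; unfold disc in *; simpl in *.
(* Both ends of [a, b] can be translated by y - s. *)
apply HD with (a + (y - s)) (b + (y - s)); [apply Ha|apply Hb|lra]; unfold disc.
- replace (a + (y - s) - a) with (y - s) by ring.
  apply Rlt_le_trans with (1 := Hy); apply Rmin_l.
- replace (b + (y - s) - b) with (y - s) by ring.
  apply Rlt_le_trans with (1 := Hy); apply Rmin_r.
Qed.

Lemma interior_dense (D : R -> Prop) (s : R) : is_interval D -> D s ->
  forall d : posreal, exists y, interior D y /\ Rabs (y - s) < d.
Proof.
intros [HD [s0 [d0 H0]]] Hs d.
set (m := Rabs (s0 - s) + 1).
assert (Hm : 0 < m) by (unfold m; pose proof (Rabs_pos (s0 - s)); lra).
pose proof (cond_pos d) as Hd.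
set (u := Rmin 1 (d / m)).
assert (Hu : 0 < u).
{ apply Rmin_pos; [lra|]. apply Rdiv_lt_0_compat; lra. }
assert (Hu1 : u <= 1) by apply Rmin_l.
assert (Hum : u * m <= d).
{ apply Rle_trans with (d / m * m).
  - apply Rmult_le_compat_r; [lra|apply Rmin_r].
  - right; field; lra. }
(* The homothety of centre s and ratio u maps a neighbourhood of s0 in D to a
   neighbourhood of its image, in D by convexity. *)
exists (s + u * (s0 - s)); split.
- assert (Hr : 0 < u * d0) by (apply Rmult_lt_0_compat; [lra|apply cond_pos]).
  exists (mkposreal _ Hr); intros z Hz; unfold disc in Hz; simpl in Hz.
  assert (Hw : D (s + (z - s) / u)).
  { apply H0; unfold disc.
    replace (s + (z - s) / u - s0) with ((z - (s + u * (s0 - s))) / u)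
      by (field; lra).
    unfold Rdiv; rewrite Rabs_mult, (Rabs_pos_eq (/ u))
      by (left; apply Rinv_0_lt_compat; lra).
    apply Rmult_lt_reg_r with u; [lra|].
    rewrite Rmult_assoc, Rinv_l by lra; lra. }
  assert (Hz' : z = s + u * ((s + (z - s) / u) - s)) by (field; lra).
  set (w := s + (z - s) / u) in *.
  destruct (Rle_dec s w).
  + apply HD with s w; auto; split; nra.
  + apply HD with w s; auto; split; nra.
- replace (s + u * (s0 - s) - s) with (u * (s0 - s)) by ring.
  rewrite Rabs_mult, (Rabs_pos_eq u) by lra.
  apply Rlt_le_trans with (2 := Hum).
  apply Rmult_lt_compat_l; unfold m; lra.
Qed.

Lemma proper_within_interior (D : R -> Prop) (s : R) : is_interval D -> D s ->
  ProperFilter (within (interior D) (locally s)).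
Proof.
intros HD Hs; split; [|apply within_filter; apply locally_filter].
intros P [d HP].
destruct (interior_dense D s HD Hs d) as [y [Hy Hys]].
exists y; apply HP; auto.
Qed.

Lemma mean_value (I : R -> Prop) (f df : R -> R) : convex I ->
  (forall s, I s -> is_derive f s (df s)) ->
  forall a b, I a -> I b -> exists m, I m /\ f b - f a = df m * (b - a).
Proof.
intros HI Hf a b Ha Hb.
assert (Hab : forall y, Rmin a b <= y <= Rmax a b -> I y).
{ intros y; unfold Rmin, Rmax; destruct (Rle_dec a b); intros Hy.
  - apply HI with a b; auto.
  - apply HI with b a; auto. }
destruct (MVT_gen f a b df) as [m [Hm E]].
- intros y Hy; apply Hf, Hab; lra.
- intros y Hy; apply continuity_pt_filterlim.
  apply (ex_derive_continuous (V := R_NormedModule)); eexists; apply Hf, Hab; lra.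
- exists m; auto.
Qed.

Lemma constant_of_derive_0 (I : R -> Prop) (f : R -> R) : convex I ->
  (forall s, I s -> is_derive f s 0) -> forall a b, I a -> I b -> f a = f b.
Proof.
intros HI Hf a b Ha Hb.
destruct (mean_value I f (fun _ => 0) HI Hf a b Ha Hb) as [m [_ E]]; lra.
Qed.

Lemma continuous_on_eps (D : R -> Prop) (f : R -> R) (s : R) :
  continuous_on D f -> D s -> forall eps : posreal, exists d : posreal,
  forall y, D y -> Rabs (y - s) < d -> Rabs (f y - f s) < eps.
Proof.
intros Hf Hs eps.
destruct (Hf s Hs (ball (f s) eps) (locally_ball (f s) eps)) as [d Hd].
exists d; intros y Hy Hys; apply Hd; auto.
Qed.

Lemma continuous_on_comp (D : R -> Prop) (f h : R -> R) :
  continuous_on D f -> (forall y, continuous h y) ->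
  continuous_on D (fun s => h (f s)).
Proof.
intros Hf Hh s Hs.
apply (filterlim_comp _ _ _ f h (within D (locally s)) (locally (f s)));
  [apply Hf; auto|apply Hh].
Qed.

Lemma continuous_on_plus (D : R -> Prop) (f g : R -> R) :
  continuous_on D f -> continuous_on D g ->
  continuous_on D (fun s => f s + g s).
Proof.
intros Hf Hg s Hs.
apply (filterlim_comp_2 (F := within D (locally s)) (G := locally (f s))
  (H := locally (g s)) f g Rplus); [apply Hf; auto|apply Hg; auto|].
apply (filterlim_plus (V := R_NormedModule)).
Qed.

Lemma continuous_on_within_interior (D : R -> Prop) (f : R -> R) (s : R) :
  continuous_on D f -> D s ->
  filterlim f (within (interior D) (locally s)) (locally (f s)).
Proof.
intros Hf Hs P HP.
destruct (Hf s Hs P HP) as [d Hd].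
exists d; intros y Hy HD; apply Hd; auto; apply interior_subset; auto.
Qed.

Lemma continuous_on_eq (D : R -> Prop) (f g : R -> R) : is_interval D ->
  continuous_on D f -> continuous_on D g ->
  (forall s, interior D s -> f s = g s) -> forall s, D s -> f s = g s.
Proof.
intros HD Hf Hg E s Hs.
pose proof (proper_within_interior D s HD Hs) as HP.
apply (filterlim_locally_unique (V := R_NormedModule)
         (F := within (interior D) (locally s)) f).
- apply continuous_on_within_interior; auto.
- apply filterlim_within_ext with (f := g).
  + intros y Hy; symmetry; auto.
  + apply continuous_on_within_interior; auto.
Qed.

(** The points of D are limits of interior points, and a limit of g at a point
    near s is a limit of values of g near s. *)
Lemma continuous_extension (D : R -> Prop) (g : R -> R) : is_interval D ->
  (forall s, interior D s -> continuous g s) ->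
  (forall s, D s -> exists l : R,
     filterlim g (within (interior D) (locally s)) (locally l)) ->
  exists G, continuous_on D G /\ forall s, interior D s -> G s = g s.
Proof.
intros HD Hg Hlim.
destruct (functional_choice (fun s l => D s ->
  filterlim g (within (interior D) (locally s)) (locally l))) as [G HG].
{ intros s; destruct (classic (D s)) as [Hs|Hs].
  - destruct (Hlim s Hs) as [l Hl]; exists l; auto.
  - exists 0; tauto. }
exists G; split.
- intros s Hs.
  apply (filterlim_locally (F := within D (locally s))); intros eps.
  pose proof (cond_pos eps) as He.
  assert (He2 : 0 < eps / 2) by lra.
  destruct (HG s Hs _ (locally_ball (G s) (mkposreal _ He2))) as [d Hd].
  assert (Hd2 : 0 < d / 2) by (pose proof (cond_pos d); lra).
  exists (mkposreal _ Hd2); intros y Hy HDy.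
  destruct (HG y HDy _ (locally_ball (G y) (mkposreal _ He2))) as [d' Hd'].
  assert (Hm : 0 < Rmin (d / 2) d') by (apply Rmin_pos; [lra|apply cond_pos]).
  destruct (interior_dense D y HD HDy (mkposreal _ Hm)) as [z [Hz Hzy]].
  simpl in Hzy.
  assert (H1 : ball (G s) (eps / 2) (g z)).
  { apply Hd; auto; change (Rabs (z - s) < d).
    change (Rabs (y - s) < d / 2) in Hy.
    replace (z - s) with ((z - y) + (y - s)) by ring.
    apply Rle_lt_trans with (1 := Rabs_triang _ _).
    pose proof (Rmin_l (d / 2) d'); lra. }
  assert (H2 : ball (G y) (eps / 2) (g z)).
  { apply Hd'; auto; change (Rabs (z - y) < d').
    pose proof (Rmin_r (d / 2) d'); lra. }
  replace (pos eps) with (eps / 2 + eps / 2) by field.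
  apply ball_triangle with (g z); auto; apply ball_sym; auto.
- intros s Hs; pose proof (interior_subset D s Hs) as HDs.
  pose proof (proper_within_interior D s HD HDs) as HP.
  apply (filterlim_locally_unique (V := R_NormedModule)
           (F := within (interior D) (locally s)) g); auto.
  intros P HP'; destruct (Hg s Hs P HP') as [d Hd].
  exists d; intros; apply Hd; auto.
Qed.

Lemma no_sign_change (I : R -> Prop) (g : R -> R) : convex I ->
  (forall s, I s -> continuous g s) -> (forall s, I s -> g s <> 0) ->
  forall a b, I a -> I b -> 0 < g a * g b.
Proof.
assert (Hlt : forall (f : R -> R) a b, a < b ->
  (forall s, a <= s <= b -> continuous f s) ->
  (forall s, a <= s <= b -> f s <> 0) -> f a < 0 -> 0 < f b -> False).
{ intros f a b Hab Hf H0 Ha Hb.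
  destruct (IVT_interv f a b) as [z [Hz Hfz]]; auto.
  - intros s Hs; apply continuity_pt_filterlim, Hf; auto.
  - exact (H0 z Hz Hfz). }
assert (Hle : forall (f : R -> R) a b, convex I ->
  (forall s, I s -> continuous f s) -> (forall s, I s -> f s <> 0) ->
  I a -> I b -> a < b -> 0 < f a * f b).
{ intros f a b HI Hf H0 Ha Hb Hab.
  assert (HIab : forall s, a <= s <= b -> I s)
    by (intros; apply HI with a b; auto).
  pose proof (H0 a Ha); pose proof (H0 b Hb).
  destruct (Rtotal_order (f a) 0) as [Ha'|[Ha'|Ha']]; try tauto;
    destruct (Rtotal_order (f b) 0) as [Hb'|[Hb'|Hb']]; try tauto; try nra;
    exfalso.
  - apply (Hlt f a b); auto.
  - apply (Hlt (fun s => - f s) a b); auto; try lra.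
    + intros s Hs; apply (continuous_opp f); auto.
    + intros s Hs; pose proof (H0 s (HIab s Hs)); lra. }
intros HI Hg H0 a b Ha Hb.
destruct (Rtotal_order a b) as [Hab|[Hab|Hab]].
- apply Hle; auto.
- subst b; pose proof (H0 a Ha); nra.
- rewrite Rmult_comm; apply Hle; auto.
Qed.

(** Where h does not vanish, g has a constant sign nearby, so it is one of the
    two continuous square roots of h; where h vanishes, g tends to 0. *)
Lemma limit_of_square_limit (D : R -> Prop) (g h : R -> R) : is_interval D ->
  (forall s, interior D s -> continuous g s) ->
  continuous_on D h -> (forall s, interior D s -> g s ^ 2 = h s) ->
  forall s, D s -> exists l : R,
    filterlim g (within (interior D) (locally s)) (locally l).
Proof.
intros HD Hg Hh E s Hs.
pose proof (interior_convex D (proj1 HD)) as HI.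
assert (Hpos : 0 <= h s).
{ destruct (Rle_dec 0 (h s)) as [|Hn]; auto; exfalso.
  assert (Hp : 0 < - h s) by lra.
  destruct (continuous_on_eps D h s Hh Hs (mkposreal _ Hp)) as [d Hd].
  destruct (interior_dense D s HD Hs d) as [y [Hy Hys]].
  specialize (Hd y (interior_subset _ _ Hy) Hys); simpl in Hd.
  apply Rabs_def2 in Hd; pose proof (E y Hy); nra. }
destruct (Req_dec (h s) 0) as [H0|H0].
- exists 0; apply (filterlim_locally (F := within (interior D) (locally s))).
  intros eps; pose proof (cond_pos eps) as He.
  assert (He2 : 0 < eps * eps) by nra.
  destruct (continuous_on_eps D h s Hh Hs (mkposreal _ He2)) as [d Hd].
  exists d; intros y Hys Hy.
  specialize (Hd y (interior_subset _ _ Hy) Hys); simpl in Hd.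
  apply Rabs_def2 in Hd; pose proof (E y Hy) as Ey.
  change (Rabs (g y - 0) < eps); apply Rabs_def1; nra.
- assert (Hp : 0 < h s) by lra.
  destruct (continuous_on_eps D h s Hh Hs (mkposreal _ Hp)) as [d Hd].
  set (I := fun y => interior D y /\ Rabs (y - s) < d).
  assert (HIc : convex I).
  { intros a b y [Ha Ha'] [Hb Hb'] Hy; split; [apply HI with a b; auto|].
    apply Rabs_def2 in Ha'; apply Rabs_def2 in Hb'; apply Rabs_def1; lra. }
  assert (Hn0 : forall y, I y -> g y <> 0).
  { intros y [Hy Hys] H.
    specialize (Hd y (interior_subset _ _ Hy) Hys); simpl in Hd.
    apply Rabs_def2 in Hd; pose proof (E y Hy) as Ey; rewrite H in Ey; nra. }
  destruct (interior_dense D s HD Hs d) as [y0 Hy0].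
  assert (Hc : forall y, I y -> continuous g y) by (intros y [Hy _]; auto).
  set (sg := if Rlt_dec 0 (g y0) then 1 else -1).
  assert (Hsg : sg ^ 2 = 1 /\ forall y, I y -> 0 < sg * g y).
  { split; [unfold sg; destruct (Rlt_dec 0 (g y0)); ring|].
    intros y Hy; pose proof (no_sign_change I g HIc Hc Hn0 y0 y Hy0 Hy).
    pose proof (Hn0 y0 Hy0).
    unfold sg; destruct (Rlt_dec 0 (g y0)); nra. }
  destruct Hsg as [Hsg2 Hsg].
  pose proof (sqrt_lt_R0 _ Hp) as Hq.
  pose proof (sqrt_sqrt (h s) Hpos) as Hqq.
  set (q := sqrt (h s)) in *.
  exists (sg * q).
  apply (filterlim_locally (F := within (interior D) (locally s))).
  intros eps; pose proof (cond_pos eps) as He.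
  assert (Heq : 0 < eps * q) by nra.
  destruct (continuous_on_eps D h s Hh Hs (mkposreal _ Heq)) as [d' Hd'].
  assert (Hm : 0 < Rmin d d') by (apply Rmin_pos; apply cond_pos).
  exists (mkposreal _ Hm); intros y Hys Hy.
  change (Rabs (y - s) < Rmin d d') in Hys.
  pose proof (Rmin_l d d'); pose proof (Rmin_r d d').
  specialize (Hd' y (interior_subset _ _ Hy) ltac:(lra)); simpl in Hd'.
  assert (HIy : I y) by (split; auto; lra).
  specialize (Hsg y HIy); pose proof (E y Hy) as Ey.
  apply Rabs_def2 in Hd'.
  set (p := sg * g y) in *.
  assert (Hpp : p * p = h y)
    by (unfold p; rewrite <- Ey; transitivity (sg ^ 2 * g y ^ 2);
        [ring|rewrite Hsg2; ring]).
  assert (Hg' : g y = sg * p)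
    by (unfold p; transitivity (sg ^ 2 * g y); [rewrite Hsg2|]; ring).
  assert (Hpq : Rabs (p - q) < eps) by (apply Rabs_def1; nra).
  change (Rabs (g y - sg * q) < eps); rewrite Hg'.
  replace (sg * p - sg * q) with (sg * (p - q)) by ring.
  rewrite Rabs_mult.
  replace (Rabs sg) with 1; [lra|].
  unfold sg; destruct (Rlt_dec 0 (g y0));
    [rewrite Rabs_R1|rewrite Rabs_left]; lra.
Qed.

Lemma polar_coordinates (r a b : R) : 0 <= r -> a ^ 2 + b ^ 2 = r ^ 2 ->
  exists phi, a = r * cos phi /\ b = r * sin phi.
Proof.
intros Hr H; destruct (Req_dec r 0) as [H0|H0].
{ exists 0; subst r; assert (a = 0) by nra; assert (b = 0) by nra; lra. }
assert (Hr' : 0 < r) by lra.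
assert (Hcd : (a / r) ^ 2 + (b / r) ^ 2 = 1).
{ replace ((a / r) ^ 2 + (b / r) ^ 2) with ((a ^ 2 + b ^ 2) / r ^ 2)
    by (field; lra).
  rewrite H; field; lra. }
assert (Hc1 : -1 <= a / r <= 1) by nra.
assert (Hs : sin (acos (a / r)) = Rabs (b / r)).
{ rewrite sin_acos by auto.
  replace (1 - Rsqr (a / r)) with (Rsqr (b / r)) by (unfold Rsqr; nra).
  apply sqrt_Rsqr_abs. }
destruct (Rle_dec 0 (b / r)) as [Hb|Hb].
- exists (acos (a / r)); rewrite cos_acos, Hs, Rabs_pos_eq by auto.
  split; field; lra.
- exists (- acos (a / r)); rewrite cos_neg, sin_neg, cos_acos, Hs, Rabs_left by lra.
  split; field; lra.
Qed.

(** * Repeated differentiability *)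

(** Differentiability n times on I, in a form suited to induction on n: the
    derivatives of products, inverses and square roots are again such
    expressions. *)
Fixpoint Dn (n : nat) (I : R -> Prop) (f : R -> R) : Prop :=
  match n with
  | O => True
  | S m => (forall s, I s -> ex_derive f s) /\ Dn m I (Derive f)
  end.

Lemma Dn_of_ex_derive_n (I : R -> Prop) (f : R -> R) :
  (forall n s, I s -> ex_derive_n f n s) -> forall n, Dn n I f.
Proof.
intros Hf n; revert f Hf; induction n as [|n IH]; intros f Hf; simpl; auto.
split; [intros s Hs; exact (Hf 1%nat s Hs)|].
apply IH; intros m s Hs; destruct m as [|m]; [exact Logic.I|].
apply ex_derive_ext with (Derive_n f (S m)); [|exact (Hf (S (S m)) s Hs)].
intros u; replace (S m) with (m + 1)%nat by lia.
symmetry; apply (Derive_n_comp f m 1 u).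
Qed.

Lemma ex_derive_n_of_Dn (I : R -> Prop) (n : nat) : forall f s,
  Dn n I f -> I s -> ex_derive_n f n s.
Proof.
induction n as [|n IH]; intros f s Hf Hs; [exact Logic.I|].
destruct Hf as [Hf Hf']; destruct n as [|n]; [apply Hf; auto|].
apply ex_derive_ext with (Derive_n (Derive f) n); [|exact (IH _ s Hf' Hs)].
intros u; replace (S n) with (n + 1)%nat by lia.
apply (Derive_n_comp f n 1 u).
Qed.

Lemma Dn_ext (I : R -> Prop) (f g : R -> R) (n : nat) : open I ->
  (forall s, I s -> f s = g s) -> Dn n I f -> Dn n I g.
Proof.
intros HI; revert f g; induction n as [|n IH]; intros f g E Hf; simpl; auto.
destruct Hf as [Hf Hf'].
assert (El : forall s, I s -> locally s (fun u => f u = g u)).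
{ intros s Hs; apply filter_imp with (2 := HI s Hs); auto. }
split.
- intros s Hs; apply ex_derive_ext_loc with f; auto.
- apply IH with (Derive f); auto.
  intros s Hs; apply Derive_ext_loc; auto.
Qed.

Lemma Dn_intro (I : R -> Prop) (f f' : R -> R) (n : nat) : open I ->
  (forall s, I s -> is_derive f s (f' s)) -> Dn n I f' -> Dn (S n) I f.
Proof.
intros HI Hf Hf'; split.
- intros s Hs; eexists; apply Hf; auto.
- apply Dn_ext with f'; auto.
  intros s Hs; symmetry; apply is_derive_unique; auto.
Qed.

Lemma Dn_pred (I : R -> Prop) (n : nat) : forall f, Dn (S n) I f -> Dn n I f.
Proof.
induction n as [|n IH]; intros f Hf; [exact Logic.I|].
split; [apply Hf|apply IH, Hf].
Qed.

Lemma Dn_is_derive (I : R -> Prop) (f : R -> R) (n : nat) (s : R) :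
  Dn (S n) I f -> I s -> is_derive f s (Derive f s).
Proof. intros [Hf _] Hs; apply Derive_correct; auto. Qed.

Lemma Dn_const (I : R -> Prop) (n : nat) : open I ->
  forall a, Dn n I (fun _ => a).
Proof.
intros HI; induction n as [|n IH]; intros a; [exact Logic.I|].
apply Dn_intro with (fun _ => 0); auto.
intros s _; apply (is_derive_const (V := R_NormedModule)).
Qed.

Lemma Dn_plus (I : R -> Prop) (n : nat) : open I -> forall f g,
  Dn n I f -> Dn n I g -> Dn n I (fun s => f s + g s).
Proof.
intros HI; induction n as [|n IH]; intros f g Hf Hg; [exact Logic.I|].
apply Dn_intro with (fun s => Derive f s + Derive g s); auto.
- intros s Hs; apply (is_derive_plus (V := R_NormedModule) f g);
    apply Dn_is_derive with I n; auto.
- apply IH; [apply Hf|apply Hg].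
Qed.

Lemma Dn_mult (I : R -> Prop) (n : nat) : open I -> forall f g,
  Dn n I f -> Dn n I g -> Dn n I (fun s => f s * g s).
Proof.
intros HI; induction n as [|n IH]; intros f g Hf Hg; [exact Logic.I|].
apply Dn_intro with (fun s => Derive f s * g s + f s * Derive g s); auto.
- intros s Hs; apply (is_derive_mult f g);
    try (apply Dn_is_derive with I n; auto); intros; apply Rmult_comm.
- pose proof (Dn_pred I n f Hf); pose proof (Dn_pred I n g Hg).
  apply Dn_plus; auto; apply IH; auto; [apply Hf|apply Hg].
Qed.

Lemma Dn_inv (I : R -> Prop) (n : nat) (f : R -> R) : open I ->
  (forall s, I s -> f s <> 0) -> Dn n I f -> Dn n I (fun s => / f s).
Proof.
intros HI H0; induction n as [|n IH]; intros Hf; [exact Logic.I|].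
pose proof (IH (Dn_pred I n f Hf)) as Hi.
apply Dn_intro with (fun s => -1 * (Derive f s * (/ f s * / f s))); auto.
- intros s Hs.
  replace (-1 * (Derive f s * (/ f s * / f s)))
    with (- Derive f s / f s ^ 2) by (field; auto).
  apply is_derive_inv; auto; apply Dn_is_derive with I n; auto.
- apply Dn_mult; auto; [apply Dn_const; auto|].
  apply Dn_mult; [auto|apply Hf|apply Dn_mult; auto].
Qed.

Lemma Dn_sqrt (I : R -> Prop) (n : nat) (f : R -> R) : open I ->
  (forall s, I s -> 0 < f s) -> Dn n I f -> Dn n I (fun s => sqrt (f s)).
Proof.
intros HI H0; induction n as [|n IH]; intros Hf; [exact Logic.I|].
pose proof (IH (Dn_pred I n f Hf)) as Hi.
assert (Hq : forall s, I s -> 2 * sqrt (f s) <> 0).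
{ intros s Hs; pose proof (sqrt_lt_R0 _ (H0 s Hs)); lra. }
apply Dn_intro with (fun s => Derive f s * / (2 * sqrt (f s))); auto.
- intros s Hs; apply is_derive_sqrt; auto; apply Dn_is_derive with I n; auto.
- apply Dn_mult; [auto|apply Hf|].
  apply Dn_inv; auto; apply Dn_mult; auto; apply Dn_const; auto.
Qed.

Lemma d1_ext (W : plane -> Prop) (f g : plane -> R) (p : plane) :
  open W -> W p -> (forall q, W q -> f q = g q) -> d1 f p = d1 g p.
Proof.
intros HW Hp E; apply Derive_ext_loc.
destruct (HW p Hp) as [d Hd]; exists d; intros u Hu; apply E, Hd.
destruct p as [p1 p2]; split; [exact Hu|apply ball_center].
Qed.

Lemma d2_ext (W : plane -> Prop) (f g : plane -> R) (p : plane) :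
  open W -> W p -> (forall q, W q -> f q = g q) -> d2 f p = d2 g p.
Proof.
intros HW Hp E; apply Derive_ext_loc.
destruct (HW p Hp) as [d Hd]; exists d; intros u Hu; apply E, Hd.
destruct p as [p1 p2]; split; [apply ball_center|exact Hu].
Qed.

Lemma Ck_ext (W : plane -> Prop) (f g : plane -> R) (n : nat) : open W ->
  (forall q, W q -> f q = g q) -> Ck n W f -> Ck n W g.
Proof.
intros HW; revert f g; induction n as [|n IH]; intros f g E Hf; simpl in *.
- intros p Hp; apply continuous_ext_loc with f; auto.
  apply filter_imp with (2 := HW p Hp); auto.
- destruct Hf as [Hf [H1 H2]]; split; [|split].
  + intros p Hp; destruct (Hf p Hp) as [Hu Hv].
    destruct (HW p Hp) as [d Hd]; split.
    * apply ex_derive_ext_loc with (2 := Hu).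
      exists d; intros u Hb; apply E, Hd.
      destruct p; split; [exact Hb|apply ball_center].
    * apply ex_derive_ext_loc with (2 := Hv).
      exists d; intros u Hb; apply E, Hd.
      destruct p; split; [apply ball_center|exact Hb].
  + apply IH with (d1 f); auto; intros q Hq; apply d1_ext with W; auto.
  + apply IH with (d2 f); auto; intros q Hq; apply d2_ext with W; auto.
Qed.

(** The normal coordinates of a rotationally invariant surface have this form,
    which is stable under both partial derivatives. *)
Lemma smooth_affine_in_second (I : R -> Prop) (W : plane -> Prop) (F : R -> R)
    (k : R) : open W -> open I -> (forall p, W p -> I (fst p)) ->
  (forall n, Dn n I F) -> smooth W (fun p => F (fst p) + k * snd p).
Proof.
intros HW HI HWI HF n; specialize (HF (S n)); revert F k HF.
induction n as [|n IH]; intros F k HF.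
- intros p Hp.
  apply (continuous_plus (V := R_NormedModule)
           (fun p : plane => F (fst p)) (fun p : plane => k * snd p)).
  + apply continuous_comp; [apply continuous_fst|].
    apply (ex_derive_continuous (V := R_NormedModule)), HF; auto.
  + apply (continuous_mult (K := R_AbsRing)
             (fun _ : plane => k) (fun p : plane => snd p)).
    * apply continuous_const.
    * apply continuous_snd.
- assert (H1 : forall p, W p ->
    is_derive (fun u => F u + k * snd p) (fst p) (Derive F (fst p))).
  { intros p Hp; rewrite <- (Rplus_0_r (Derive F (fst p))).
    apply (is_derive_plus (V := R_NormedModule) F (fun _ => k * snd p)).
    - apply Dn_is_derive with I (S n); auto.
    - apply (is_derive_const (V := R_NormedModule)). }
  assert (H2 : forall p : plane,
    is_derive (fun v => F (fst p) + k * v) (snd p) k).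
  { intros p; auto_derive; auto; ring. }
  split; [|split].
  + intros p Hp; split; eexists; [apply H1; auto|apply H2].
  + apply Ck_ext with (fun p => Derive F (fst p) + 0 * snd p); auto.
    * intros p Hp; symmetry; unfold d1; simpl.
      rewrite Rmult_0_l, Rplus_0_r; apply is_derive_unique, H1; auto.
    * apply IH, HF.
  + apply Ck_ext with (fun p => (fun _ => k) (fst p) + 0 * snd p); auto.
    * intros p Hp; symmetry; unfold d2; simpl.
      rewrite Rmult_0_l, Rplus_0_r; apply is_derive_unique, H2; auto.
    * apply (IH (fun _ => k) 0), Dn_const; auto.
Qed.

(** * Geometry of a rotationally invariant surface *)

Definition speed (x t : R -> R) (s : R) : R :=
  sqrt (x s ^ 2 * Derive x s ^ 2 + Derive t s ^ 2).

(** In the frame rotated by theta, e_1 = rad E1 + ang E2. *)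
Definition rad (x t : R -> R) (s : R) : R := x s * Derive x s / speed x t s.
Definition ang (x t : R -> R) (s : R) : R := - Derive t s / speed x t s.

Lemma speed_rad_ang (dom : R -> Prop) (x t : R -> R) (s : R) :
  generating_curve dom x t -> interior dom s ->
  0 < x s /\ 0 < speed x t s /\
  Derive x s = rad x t s * speed x t s / x s /\
  Derive t s = - ang x t s * speed x t s /\
  rad x t s ^ 2 + ang x t s ^ 2 = 1.
Proof.
intros G Hs.
assert (Hx : 0 < x s).
{ pose proof (gc_nonneg _ _ _ G s (interior_subset _ _ Hs)).
  pose proof (gc_immersed _ _ _ G s Hs); lra. }
pose proof (gc_unit _ _ _ G s Hs) as H1.
assert (Hp : 0 < x s ^ 2 * Derive x s ^ 2 + Derive t s ^ 2).
{ destruct (Req_dec (Derive t s) 0) as [E|E]; [|nra].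
  rewrite E in *; nra. }
pose proof (sqrt_lt_R0 _ Hp) as HD.
pose proof (sqrt_sqrt _ (Rlt_le _ _ Hp)) as HDD.
fold (speed x t s) in HD, HDD.
unfold rad, ang; repeat split; auto; try (field; lra).
replace ((x s * Derive x s / speed x t s) ^ 2 + (- Derive t s / speed x t s) ^ 2)
  with ((x s ^ 2 * Derive x s ^ 2 + Derive t s ^ 2)
        / (speed x t s * speed x t s)) by (field; lra).
rewrite HDD; field; lra.
Qed.

(* auto_derive leaves eta-expanded functions under Derive. *)
Ltac eta_Derive :=
  repeat match goal with
  | |- context [Derive (fun y => ?f y) ?s] =>
      progress change (Derive (fun y => f y) s) with (Derive f s)
  end.

Section Smooth.
Context (dom : R -> Prop) (x t : R -> R) (G : generating_curve dom x t).

Let HI : open (interior dom) := locally_interior dom.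

Lemma Dn_x (n : nat) : Dn n (interior dom) x.
Proof. apply Dn_of_ex_derive_n; intros; apply (gc_smoothx _ _ _ G); auto. Qed.

Lemma Dn_Dx (n : nat) : Dn n (interior dom) (Derive x).
Proof. apply (Dn_x (S n)). Qed.

Lemma Dn_Dt (n : nat) : Dn n (interior dom) (Derive t).
Proof.
apply (Dn_of_ex_derive_n _ t (fun n s => gc_smootht _ _ _ G n s) (S n)).
Qed.

Lemma Dn_speed (n : nat) : Dn n (interior dom) (speed x t).
Proof.
assert (H2 : forall f, Dn n (interior dom) f ->
  Dn n (interior dom) (fun s => f s ^ 2)).
{ intros f Hf; apply Dn_ext with (fun s => f s * f s); auto.
  - intros; ring.
  - apply Dn_mult; auto. }
apply Dn_sqrt; auto.
- intros s Hs; destruct (speed_rad_ang _ _ _ s G Hs) as [_ [H _]].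
  apply Rnot_le_lt; intros H0; unfold speed in H.
  rewrite sqrt_neg_0 in H; lra.
- apply Dn_plus; auto; [apply Dn_mult|]; auto; apply H2;
    [apply Dn_x|apply Dn_Dx|apply Dn_Dt].
Qed.

Lemma Dn_inv_speed (n : nat) : Dn n (interior dom) (fun s => / speed x t s).
Proof.
apply Dn_inv; auto; [|apply Dn_speed].
intros s Hs; destruct (speed_rad_ang _ _ _ s G Hs) as [_ [H _]]; lra.
Qed.

Lemma Dn_inv_x (n : nat) : Dn n (interior dom) (fun s => / x s).
Proof.
apply Dn_inv; auto; [|apply Dn_x].
intros s Hs; apply (gc_immersed _ _ _ G); auto.
Qed.

Lemma Dn_rad (n : nat) : Dn n (interior dom) (rad x t).
Proof.
unfold rad, Rdiv; apply Dn_mult; [auto| |apply Dn_inv_speed].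
apply Dn_mult; auto; [apply Dn_x|apply Dn_Dx].
Qed.

Lemma Dn_ang (n : nat) : Dn n (interior dom) (ang x t).
Proof.
apply Dn_ext with (fun s => -1 * (Derive t s * / speed x t s)); auto.
- intros; unfold ang, Rdiv; ring.
- apply Dn_mult; auto; [apply Dn_const; auto|].
  apply Dn_mult; auto; [apply Dn_Dt|apply Dn_inv_speed].
Qed.

Lemma is_derive_x (s : R) : interior dom s -> is_derive x s (Derive x s).
Proof. apply Dn_is_derive with (n := O); apply Dn_x. Qed.

Lemma is_derive_t (s : R) : interior dom s -> is_derive t s (Derive t s).
Proof.
intros Hs; apply Derive_correct; exact (gc_smootht _ _ _ G 1%nat s Hs).
Qed.

Lemma is_derive_rad (s : R) :
  interior dom s -> is_derive (rad x t) s (Derive (rad x t) s).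
Proof. apply Dn_is_derive with (n := O); apply Dn_rad. Qed.

Lemma is_derive_ang (s : R) :
  interior dom s -> is_derive (ang x t) s (Derive (ang x t) s).
Proof. apply Dn_is_derive with (n := O); apply Dn_ang. Qed.

Lemma rad_ang_derive (s : R) : interior dom s ->
  rad x t s * Derive (rad x t) s + ang x t s * Derive (ang x t) s = 0.
Proof.
intros Hs.
assert (H : is_derive (fun u => rad x t u * rad x t u + ang x t u * ang x t u) s
  (2 * (rad x t s * Derive (rad x t) s + ang x t s * Derive (ang x t) s))).
{ pose proof (is_derive_rad s Hs) as Hr; pose proof (is_derive_ang s Hs) as Ha.
  auto_derive; [repeat split; eexists; eassumption|eta_Derive; ring]. }
apply is_derive_unique in H.
rewrite (Derive_ext_loc _ (fun _ => 1)), Derive_const in H; [lra|].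
apply filter_imp with (2 := HI s Hs); intros u Hu.
destruct (speed_rad_ang _ _ _ u G Hu) as [_ [_ [_ [_ E]]]]; lra.
Qed.

Lemma dX_rot_surface (p w : plane) : rot_domain dom p ->
  let s := fst p in let th := snd p in
  dX (rot_surface x t) p w =
  (fst w * Derive x s * cos th - snd w * x s * sin th,
   fst w * Derive x s * sin th + snd w * x s * cos th,
   fst w * Derive t s).
Proof.
intros Hp s th; unfold rot_domain in Hp; fold s in Hp.
pose proof (is_derive_x s Hp) as Hx.
assert (Hcs : forall a, Derive (fun u => x u * a) s = Derive x s * a).
{ intros a; apply is_derive_unique.
  auto_derive; [eexists; exact Hx|eta_Derive; ring]. }
unfold dX, dir, d1, d2, rot_surface, px, py, pz; simpl; fold s th.
rewrite !Hcs.
rewrite (is_derive_unique (fun v : R => x s * cos v) th (- (x s * sin th)))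
  by (auto_derive; auto; ring).
rewrite (is_derive_unique (fun v : R => x s * sin v) th (x s * cos th))
  by (auto_derive; auto; ring).
rewrite Derive_const; eta_Derive.
f_equal; [f_equal|]; ring.
Qed.

Lemma rot_surface_regular (p : plane) :
  rot_domain dom p -> regular (rot_surface x t) p.
Proof.
intros Hp Hsing.
(* d/dtheta is not horizontal: Theta takes the value x^2 on it. *)
assert (H : horizontal (rot_surface x t p) (dX (rot_surface x t) p (0, 1))).
{ apply Hsing; exists (0, 1); reflexivity. }
rewrite dX_rot_surface in H by auto.
unfold horizontal, Theta, rot_surface, px, py, pz in H; simpl in H.
destruct (speed_rad_ang _ _ _ _ G Hp) as [Hx _].
pose proof (sin2_cos2 (snd p)) as Hsc; unfold Rsqr in Hsc.
assert (x (fst p) ^ 2 * (sin (snd p) * sin (snd p) + cos (snd p) * cos (snd p)) = 0)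
  by (rewrite <- H; ring).
rewrite Hsc in *; nra.
Qed.

End Smooth.

(** Theta = 0 gives the direction of e_1, the unit norm its length, and the
    choice of the orientation its sign. *)
Lemma char_field_rot (dom : R -> Prop) (x t : R -> R) (e : plane -> plane)
    (p : plane) :
  generating_curve dom x t -> rot_characteristic_field dom x t e ->
  rot_domain dom p ->
  e p = (x (fst p) / speed x t (fst p), ang x t (fst p) / x (fst p)).
Proof.
intros G [He Hpos] Hp.
destruct (He p Hp (rot_surface_regular dom x t G p Hp)) as [Hh Hn].
specialize (Hpos p Hp).
unfold hnorm in Hn; rewrite Hh in Hn.
unfold horizontal, Theta in Hh.
rewrite (dX_rot_surface dom x t G) in Hh, Hn by auto.
destruct (speed_rad_ang _ _ _ _ G Hp) as [Hx [HD [Ex [Et E1]]]].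
destruct (e p) as [a b]; unfold rot_surface, px, py, pz in *; cbn [fst snd] in *.
rewrite Ex, Et in *.
pose proof (sin2_cos2 (snd p)) as Hsc; unfold Rsqr in Hsc.
set (X := x (fst p)) in *; set (D := speed x t (fst p)) in *.
set (u := rad x t (fst p)) in *; set (v := ang x t (fst p)) in *.
set (S := sin (snd p)) in *; set (C := cos (snd p)) in *.
assert (Hb : b = a * v * D / X ^ 2).
{ assert (H : X ^ 2 * (S * S + C * C) * b = a * v * D).
  { apply Rminus_diag_uniq; rewrite <- Hh; ring. }
  rewrite Hsc in H; rewrite <- H; field; lra. }
assert (Ha : a ^ 2 * (D / X) ^ 2 = 1).
{ match type of Hn with sqrt ?z = 1 => assert (Hz : z = 1) end.
  { apply sqrt_inj; [|lra|rewrite sqrt_1; exact Hn].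
    repeat apply Rplus_le_le_0_compat; apply pow2_ge_0. }
  transitivity (a ^ 2 * (D / X) ^ 2 * ((u ^ 2 + v ^ 2) * (S * S + C * C))).
  - rewrite E1, Hsc; ring.
  - match type of Hz with ?z = 1 => transitivity z; [|exact Hz] end.
    rewrite Hb; field; lra. }
assert (HDX : 0 < D / X) by (apply Rdiv_lt_0_compat; lra).
assert (HaD : a * (D / X) = 1).
{ assert (H1 : 0 < a * (D / X)) by (apply Rmult_lt_0_compat; auto).
  assert (H2 : (a * (D / X)) ^ 2 = 1) by (rewrite <- Ha; ring).
  nra. }
assert (Ha' : a = X / D).
{ transitivity (a * (D / X) * (X / D)); [field; lra|rewrite HaD; ring]. }
rewrite Hb, Ha'; f_equal; field; lra.
Qed.

Lemma dX_char_field (dom : R -> Prop) (x t : R -> R) (e : plane -> plane)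
    (p : plane) :
  generating_curve dom x t -> rot_characteristic_field dom x t e ->
  rot_domain dom p ->
  let s := fst p in let th := snd p in
  dX (rot_surface x t) p (e p) =
  (rad x t s * cos th - ang x t s * sin th,
   rad x t s * sin th + ang x t s * cos th,
   - x s * ang x t s).
Proof.
intros G He Hp s th.
rewrite (dX_rot_surface dom x t G) by auto.
rewrite (char_field_rot dom x t e p G He Hp); simpl; fold s th.
destruct (speed_rad_ang _ _ _ _ G Hp) as [Hx [HD [Ex [Et _]]]]; fold s in Hx, HD, Ex, Et.
rewrite Ex, Et; f_equal; [f_equal|]; field; lra.
Qed.

Lemma frame_horizontal (p : H1) (a b : R) :
  frame p a b 0 = (a, b, a * py p - b * px p).
Proof.
destruct p as [[x y] z].
unfold frame, E1, E2, T, px, py, pz, plus, scal; simpl.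
unfold prod_plus, prod_scal, plus, scal; simpl.
unfold prod_plus, prod_scal, plus, scal, mult; simpl; unfold mult; simpl.
f_equal; [f_equal|]; ring.
Qed.

Lemma e2_rot (dom : R -> Prop) (x t : R -> R) (e : plane -> plane)
    (p : plane) :
  generating_curve dom x t -> rot_characteristic_field dom x t e ->
  rot_domain dom p ->
  let s := fst p in let th := snd p in
  e2 (rot_surface x t) e p =
  (- (rad x t s * sin th + ang x t s * cos th),
   rad x t s * cos th - ang x t s * sin th,
   - x s * rad x t s).
Proof.
intros G He Hp s th; unfold e2.
rewrite (dX_char_field dom x t e p G He Hp); fold s th.
unfold Jxi; rewrite frame_horizontal; unfold rot_surface, px, py; simpl.
fold s th; f_equal.
pose proof (sin2_cos2 th) as Hsc; unfold Rsqr in Hsc.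
transitivity (- x s * rad x t s * (sin th * sin th + cos th * cos th));
  [ring|rewrite Hsc; ring].
Qed.

Lemma open_rot_domain (dom : R -> Prop) : open (rot_domain dom).
Proof.
intros [p1 p2] Hp; destruct (locally_interior dom p1 Hp) as [d Hd].
exists d; intros [q1 q2] [H1 _]; apply Hd; exact H1.
Qed.

Lemma dir_ext (W : plane -> Prop) (f g : plane -> R) (p w : plane) :
  open W -> W p -> (forall q, W q -> f q = g q) -> dir f p w = dir g p w.
Proof.
intros HW Hp E; unfold dir.
rewrite (d1_ext W f g p), (d2_ext W f g p); auto.
Qed.

(** As theta and the polar angle of (rad, ang) add up to the angle of e_1 in
    the frame, H is the derivative of that sum along e_1. *)
Definition rot_curvature (x t : R -> R) (s : R) : R :=
  (rad x t s * Derive (ang x t) s - ang x t s * Derive (rad x t) s)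
  * (x s / speed x t s) + ang x t s / x s.

Lemma pmean_curvature_rot (dom : R -> Prop) (x t : R -> R)
    (e : plane -> plane) (p : plane) (H : R) :
  generating_curve dom x t -> rot_characteristic_field dom x t e ->
  rot_domain dom p ->
  (pmean_curvature_at (rot_surface x t) e p H <->
   rot_curvature x t (fst p) = H).
Proof.
intros G He Hp; set (s := fst p); set (th := snd p).
destruct (speed_rad_ang _ _ _ _ G Hp) as [Hx [HD [_ [_ E1]]]].
fold s in Hx, HD, E1.
unfold pmean_curvature_at, nabla.
rewrite (dX_char_field dom x t e p G He Hp); fold s th.
pose proof (is_derive_rad dom x t G s Hp) as Hr.
pose proof (is_derive_ang dom x t G s Hp) as Ha.
pose proof (rad_ang_derive dom x t G s Hp) as Hra.
rewrite (dir_ext (rot_domain dom) (fun q => px (e2 (rot_surface x t) e q))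
  (fun q => - (rad x t (fst q) * sin (snd q) + ang x t (fst q) * cos (snd q))))
  by (auto using open_rot_domain; intros q Hq;
      rewrite (e2_rot dom x t e q G He Hq); reflexivity).
rewrite (dir_ext (rot_domain dom) (fun q => py (e2 (rot_surface x t) e q))
  (fun q => rad x t (fst q) * cos (snd q) - ang x t (fst q) * sin (snd q)))
  by (auto using open_rot_domain; intros q Hq;
      rewrite (e2_rot dom x t e q G He Hq); reflexivity).
rewrite (dir_ext (rot_domain dom)
  (fun q => Theta (rot_surface x t q) (e2 (rot_surface x t) e q))
  (fun _ => 0)).
2: apply open_rot_domain.
2: exact Hp.
2: { intros q Hq; unfold e2, Jxi; rewrite frame_horizontal.
     unfold Theta, px, py, pz; simpl; ring. }
rewrite (char_field_rot dom x t e p G He Hp).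
unfold dir, d1, d2; simpl; fold s th.
rewrite (is_derive_unique (fun u : R => - (rad x t u * sin th + ang x t u * cos th)) s
  (- (Derive (rad x t) s * sin th + Derive (ang x t) s * cos th)))
  by (auto_derive; [repeat split; eexists; eassumption|eta_Derive; ring]).
rewrite (is_derive_unique (fun v : R => - (rad x t s * sin v + ang x t s * cos v)) th
  (- (rad x t s * cos th - ang x t s * sin th)))
  by (auto_derive; auto; ring).
rewrite (is_derive_unique (fun u : R => rad x t u * cos th - ang x t u * sin th) s
  (Derive (rad x t) s * cos th - Derive (ang x t) s * sin th))
  by (auto_derive; [repeat split; eexists; eassumption|eta_Derive; ring]).
rewrite (is_derive_unique (fun v : R => rad x t s * cos v - ang x t s * sin v) th
  (- (rad x t s * sin th + ang x t s * cos th)))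
  by (auto_derive; auto; ring).
rewrite !Derive_const, !Rmult_0_r, Rplus_0_r, frame_horizontal.
unfold rot_curvature.
pose proof (sin2_cos2 th) as Hsc; unfold Rsqr in Hsc.
unfold rot_surface, px, py; simpl; fold s th.
set (u := rad x t s) in *; set (v := ang x t s) in *.
set (u' := Derive (rad x t) s) in *; set (v' := Derive (ang x t) s) in *.
set (S := sin th) in *; set (C := cos th) in *.
set (X := x s) in *; set (D := speed x t s) in *.
set (K := u * v' - v * u').
(* (u', v') is orthogonal to the unit vector (u, v). *)
assert (Hu' : u' = - v * K).
{ unfold K; transitivity (u' * (u ^ 2 + v ^ 2) - u * (u * u' + v * v'));
    [rewrite E1, Hra|]; ring. }
assert (Hv' : v' = u * K).
{ unfold K; transitivity (v' * (u ^ 2 + v ^ 2) - v * (u * u' + v * v'));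
    [rewrite E1, Hra|]; ring. }
clearbody K; rewrite Hu', Hv'; clear Hu' Hv' Hra Hr Ha.
set (h := K * (X / D) + v / X).
assert (E : forall k, scal (- k) ((u * C - v * S, u * S + v * C, - X * v) : H1) =
  (- k * (u * C - v * S), - k * (u * S + v * C), - k * (- X * v))).
{ reflexivity. }
rewrite E.
assert (E' : (X / D * - (- v * K * S + u * K * C) + v / X * - (u * C - v * S),
   X / D * (- v * K * C - u * K * S) + v / X * - (u * S + v * C),
   (X / D * - (- v * K * S + u * K * C) + v / X * - (u * C - v * S)) * (X * S) -
   (X / D * (- v * K * C - u * K * S) + v / X * - (u * S + v * C)) * (X * C)) =
  (- h * (u * C - v * S), - h * (u * S + v * C), - h * (- X * v))).
{ unfold h; f_equal; [f_equal; ring|].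
  transitivity (X * v * (K * (X / D) + v / X) * (S * S + C * C)); [ring|].
  rewrite Hsc; ring. }
rewrite E'; split.
- intros EH; injection EH; intros H3 H2' H1'.
  assert (F : (u ^ 2 + v ^ 2) * (S * S + C * C) * (h - H) = 0).
  { transitivity (- (- h * (u * C - v * S) - - H * (u * C - v * S)) * (u * C - v * S)
      - (- h * (u * S + v * C) - - H * (u * S + v * C)) * (u * S + v * C));
      [ring|rewrite H1', H2'; ring]. }
  rewrite E1, Hsc in F; lra.
- intros <-; reflexivity.
Qed.

Lemma dX_rot_surface_inj (dom : R -> Prop) (x t : R -> R) (p w w' : plane) :
  generating_curve dom x t -> rot_domain dom p ->
  dX (rot_surface x t) p w = dX (rot_surface x t) p w' -> w = w'.
Proof.
intros G Hp; rewrite !(dX_rot_surface dom x t G) by auto.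
destruct (speed_rad_ang _ _ _ _ G Hp) as [Hx _].
pose proof (gc_unit _ _ _ G _ Hp) as Hu.
destruct w as [a b]; destruct w' as [a' b']; cbn [fst snd].
set (X := x (fst p)) in *; set (Dx := Derive x (fst p)) in *.
set (Dt := Derive t (fst p)) in *.
pose proof (sin2_cos2 (snd p)) as Hsc; unfold Rsqr in Hsc.
set (S := sin (snd p)) in *; set (C := cos (snd p)) in *.
intros E; injection E; intros H3 H2 H1.
assert (Ha : (a - a') * Dx * (S * S + C * C) = 0).
{ transitivity ((a * Dx * C - b * X * S - (a' * Dx * C - b' * X * S)) * C
    + (a * Dx * S + b * X * C - (a' * Dx * S + b' * X * C)) * S);
  [ring|rewrite H1, H2; ring]. }
assert (Hb : (b - b') * X * (S * S + C * C) = 0).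
{ transitivity ((a * Dx * S + b * X * C - (a' * Dx * S + b' * X * C)) * C
    - (a * Dx * C - b * X * S - (a' * Dx * C - b' * X * S)) * S);
  [ring|rewrite H1, H2; ring]. }
rewrite Hsc, Rmult_1_r in Ha, Hb.
apply Rmult_integral in Hb.
f_equal; [|lra].
assert (F : (a - a') * (Dx ^ 2 + Dt ^ 2) = 0).
{ transitivity ((a - a') * Dx * Dx + (a * Dt - a' * Dt) * Dt);
  [ring|rewrite Ha, H3; ring]. }
rewrite Hu in F; lra.
Qed.

(** Components in the parameter plane of the vector alpha e_2 + T. *)
Definition rot_normal (x t : R -> R) (s : R) : plane :=
  (- ang x t s / speed x t s, rad x t s ^ 2 / x s ^ 2).

(** Both alpha and the components w are determined by the equation, because
    (e_1, e_2, T) is a frame and the surface is immersed: there is one tangent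
    vector in alpha e_2 + T for a single value of alpha. *)
Lemma alpha_rot (dom : R -> Prop) (x t : R -> R) (e : plane -> plane)
    (p w : plane) (alpha : R) :
  generating_curve dom x t -> rot_characteristic_field dom x t e ->
  rot_domain dom p ->
  (dX (rot_surface x t) p w = alpha_e2_T (rot_surface x t) e p alpha <->
   alpha = rad x t (fst p) / x (fst p) /\ w = rot_normal x t (fst p)).
Proof.
intros G He Hp.
assert (E0 : alpha_e2_T (rot_surface x t) e p alpha =
  (alpha * - (rad x t (fst p) * sin (snd p) + ang x t (fst p) * cos (snd p)),
   alpha * (rad x t (fst p) * cos (snd p) - ang x t (fst p) * sin (snd p)),
   1 - alpha * x (fst p) * rad x t (fst p))).
{ unfold alpha_e2_T; rewrite (e2_rot dom x t e p G He Hp).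
  unfold T, plus, scal; simpl; unfold prod_plus, prod_scal, plus, scal; simpl.
  unfold prod_plus, prod_scal, plus, scal; simpl; unfold mult, plus; simpl.
  f_equal; [f_equal|]; ring. }
rewrite E0; clear E0.
assert (Hw : dX (rot_surface x t) p (rot_normal x t (fst p)) =
  (rad x t (fst p) / x (fst p) * - (rad x t (fst p) * sin (snd p) + ang x t (fst p) * cos (snd p)),
   rad x t (fst p) / x (fst p) * (rad x t (fst p) * cos (snd p) - ang x t (fst p) * sin (snd p)),
   1 - rad x t (fst p) / x (fst p) * x (fst p) * rad x t (fst p))).
{ rewrite (dX_rot_surface dom x t G) by auto.
  destruct (speed_rad_ang _ _ _ _ G Hp) as [Hx [HD [Ex [Et E1]]]].
  unfold rot_normal; cbn [fst snd]; rewrite Ex, Et.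
  rewrite <- E1; f_equal; [f_equal|]; field; lra. }
split; [|intros [-> ->]; exact Hw].
intros Hd.
assert (Ha : alpha = rad x t (fst p) / x (fst p)).
{ revert Hd; rewrite (dX_rot_surface dom x t G) by auto.
  destruct (speed_rad_ang _ _ _ _ G Hp) as [Hx [HD [Ex [Et E1]]]].
  rewrite Ex, Et; destruct w as [a b]; cbn [fst snd].
  pose proof (sin2_cos2 (snd p)) as Hsc; unfold Rsqr in Hsc.
  set (X := x (fst p)) in *; set (D := speed x t (fst p)) in *.
  set (u := rad x t (fst p)) in *; set (v := ang x t (fst p)) in *.
  set (S := sin (snd p)) in *; set (C := cos (snd p)) in *.
  intros E; injection E; intros H3 H2 H1.
  (* The radial component of the equation. *)
  assert (F1 : a * (u * D / X) * (S * S + C * C) = - alpha * v * (S * S + C * C)).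
  { transitivity ((a * (u * D / X) * C - b * X * S) * C
      + (a * (u * D / X) * S + b * X * C) * S); [ring|rewrite H1, H2; ring]. }
  rewrite Hsc, !Rmult_1_r in F1.
  assert (F2 : a * D * u = - alpha * v * X).
  { transitivity (a * (u * D / X) * X); [field; lra|rewrite F1; ring]. }
  assert (F3 : a * D * v = alpha * X * u - 1) by lra.
  assert (F4 : u = alpha * X * (u ^ 2 + v ^ 2)).
  { transitivity (alpha * X * u ^ 2 - u * (alpha * X * u - 1)); [ring|].
    rewrite <- F3; transitivity (alpha * X * u ^ 2 - v * (a * D * u)); [ring|].
    rewrite F2; ring. }
  rewrite E1, Rmult_1_r in F4; rewrite F4; field; lra. }
split; auto.
apply (dX_rot_surface_inj dom x t p); auto.
rewrite Hw, <- Ha; exact Hd.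
Qed.

Lemma alpha_at_rot (dom : R -> Prop) (x t : R -> R) (e : plane -> plane)
    (p : plane) (alpha : R) :
  generating_curve dom x t -> rot_characteristic_field dom x t e ->
  rot_domain dom p ->
  (alpha_at (rot_surface x t) e p alpha <-> alpha = rad x t (fst p) / x (fst p)).
Proof.
intros G He Hp; split.
- intros [w Hw]; symmetry in Hw.
  apply (alpha_rot dom x t e p w alpha G He Hp) in Hw; tauto.
- intros Ha; exists (rot_normal x t (fst p)); symmetry.
  apply (alpha_rot dom x t e p _ alpha G He Hp); auto.
Qed.

(** The velocity along theta of a horizontal curve is forced by Theta = 0. *)
Lemma horizontal_lift_iff (dom : R -> Prop) (x t th : R -> R) :
  generating_curve dom x t ->
  (horizontal_lift dom x t th <->
   forall s, interior dom s -> is_derive th s (- Derive t s / x s ^ 2)).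
Proof.
intros G.
assert (V : forall s d, interior dom s -> is_derive th s d ->
  Theta (lifted_curve x t th s) (velocity (lifted_curve x t th) s) =
    Derive t s + x s ^ 2 * d).
{ intros s d Hs Hd.
  pose proof (is_derive_x dom x t G s Hs) as Hx.
  unfold velocity, lifted_curve, rot_surface, Theta, px, py, pz; cbn [fst snd].
  rewrite (is_derive_unique (fun u : R => x u * cos (th u)) s
    (Derive x s * cos (th s) - x s * d * sin (th s)))
    by (auto_derive; [repeat split; eexists; eassumption|eta_Derive;
        rewrite (is_derive_unique _ _ _ Hd); ring]).
  rewrite (is_derive_unique (fun u : R => x u * sin (th u)) s
    (Derive x s * sin (th s) + x s * d * cos (th s)))
    by (auto_derive; [repeat split; eexists; eassumption|eta_Derive;
        rewrite (is_derive_unique _ _ _ Hd); ring]).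
  pose proof (sin2_cos2 (th s)) as Hsc; unfold Rsqr in Hsc.
  eta_Derive.
  transitivity (Derive t s
    + x s ^ 2 * d * (sin (th s) * sin (th s) + cos (th s) * cos (th s)));
    [ring|rewrite Hsc; ring]. }
split; intros H s Hs; pose proof (gc_immersed _ _ _ G s Hs) as Hx.
- destruct (H s Hs) as [[d Hd] Hh].
  unfold horizontal in Hh; rewrite (V s d Hs Hd) in Hh.
  assert (E : @eq R (- Derive t s / x s ^ 2) d).
  { replace (Derive t s) with (- (x s ^ 2 * d)) by lra; field; auto. }
  rewrite E; exact Hd.
- specialize (H s Hs); split; [eexists; exact H|].
  unfold horizontal; rewrite (V s _ Hs H); field; auto.
Qed.

Lemma lift_velocity_norm (dom : R -> Prop) (x t th : R -> R) (s : R) :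
  generating_curve dom x t -> horizontal_lift dom x t th -> interior dom s ->
  hnorm (lifted_curve x t th s) (velocity (lifted_curve x t th) s) =
  speed x t s / x s.
Proof.
intros G H Hs; destruct (H s Hs) as [_ Hh].
pose proof (proj1 (horizontal_lift_iff dom x t th G) H s Hs) as Hd.
pose proof (is_derive_x dom x t G s Hs) as Hx.
destruct (speed_rad_ang _ _ _ _ G Hs) as [Hxp [HD [Ex [Et E1]]]].
unfold hnorm; rewrite Hh.
unfold velocity, lifted_curve, rot_surface, px, py, pz; cbn [fst snd].
rewrite (is_derive_unique (fun u : R => x u * cos (th u)) s
  (Derive x s * cos (th s) + Derive t s / x s * sin (th s)))
  by (auto_derive; [repeat split; eexists; eassumption|eta_Derive;
      rewrite (is_derive_unique _ _ _ Hd); field; lra]).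
rewrite (is_derive_unique (fun u : R => x u * sin (th u)) s
  (Derive x s * sin (th s) - Derive t s / x s * cos (th s)))
  by (auto_derive; [repeat split; eexists; eassumption|eta_Derive;
      rewrite (is_derive_unique _ _ _ Hd); field; lra]).
rewrite Ex, Et.
pose proof (sin2_cos2 (th s)) as Hsc; unfold Rsqr in Hsc.
set (X := x s) in *; set (D := speed x t s) in *.
set (u := rad x t s) in *; set (v := ang x t s) in *.
set (S := sin (th s)) in *; set (C := cos (th s)) in *.
transitivity (sqrt ((D / X) ^ 2)).
- f_equal.
  transitivity ((D / X) ^ 2 * (u ^ 2 + v ^ 2) * (S * S + C * C));
    [field; lra|rewrite E1, Hsc; ring].
- apply sqrt_pow2; left; apply Rdiv_lt_0_compat; auto.
Qed.

(** The lift is a primitive of - t' / x^2. *)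
Lemma exists_horizontal_lift (dom : R -> Prop) (x t : R -> R) :
  generating_curve dom x t -> exists th, horizontal_lift dom x t th.
Proof.
intros G; destruct (gc_dom _ _ _ G) as [HD [s0 H0]].
set (f := fun s => - Derive t s / x s ^ 2).
exists (RInt f s0); apply (horizontal_lift_iff dom x t _ G); intros s Hs.
assert (Hf : forall u, interior dom u -> continuous f u).
{ intros u Hu; apply (ex_derive_continuous (V := R_NormedModule)).
  destruct (Dn_Dt dom x t G 1) as [HDt _]; specialize (HDt u Hu).
  pose proof (is_derive_x dom x t G u Hu) as Hx.
  pose proof (gc_immersed _ _ _ G u Hu) as Hx0.
  unfold f; auto_derive; repeat split; try (eexists; eassumption); auto. }
pose proof (interior_convex dom HD) as HI.
apply (is_derive_RInt f (RInt f s0) s0); [|apply Hf; auto].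
apply filter_imp with (2 := locally_interior dom s Hs).
intros u Hu; apply (RInt_correct (V := R_CompleteNormedModule)).
apply (ex_RInt_continuous (V := R_CompleteNormedModule)).
intros z Hz; apply Hf.
unfold Rmin, Rmax in Hz; destruct (Rle_dec s0 u);
  [apply HI with s0 u|apply HI with u s0]; auto.
Qed.

Lemma horizontal_arclength_derive (dom : R -> Prop) (x t sig : R -> R) :
  generating_curve dom x t -> horizontal_arclength dom x t sig ->
  exists th, horizontal_lift dom x t th /\
  forall s, interior dom s -> is_derive sig s (speed x t s / x s).
Proof.
intros G [_ [th [Hth H]]]; exists th; split; auto.
intros s Hs; rewrite <- (lift_velocity_norm dom x t th s G Hth Hs); auto.
Qed.

(** * Constant curvature: the first integral *)

Lemma energy_ang (x t : R -> R) (c s : R) :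
  energy c x t s = c / 2 * x s ^ 2 - x s * ang x t s.
Proof. unfold energy, ang; fold (speed x t s); unfold Rdiv; ring. Qed.

(** Solving the definition of H for the derivatives of (rad, ang), which form
    a unit vector. *)
Lemma rad_ang_equations (dom : R -> Prop) (x t : R -> R) (s : R) :
  generating_curve dom x t -> interior dom s ->
  let k := (rot_curvature x t s - ang x t s / x s) * (speed x t s / x s) in
  Derive (rad x t) s = - ang x t s * k /\ Derive (ang x t) s = rad x t s * k.
Proof.
intros G Hs k.
destruct (speed_rad_ang _ _ _ _ G Hs) as [Hx [HD [_ [_ E1]]]].
pose proof (rad_ang_derive dom x t G s Hs) as H.
assert (Hk : k = rad x t s * Derive (ang x t) s - ang x t s * Derive (rad x t) s).
{ unfold k, rot_curvature; field; lra. }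
rewrite Hk; clear Hk k.
set (u := rad x t s) in *; set (v := ang x t s) in *.
set (u' := Derive (rad x t) s) in *; set (v' := Derive (ang x t) s) in *.
split.
- transitivity (u' * (u ^ 2 + v ^ 2) - u * (u * u' + v * v'));
    [rewrite E1, H|]; ring.
- transitivity (v' * (u ^ 2 + v ^ 2) - v * (u * u' + v * v'));
    [rewrite E1, H|]; ring.
Qed.

(** The derivative of the energy is x x' (c - H). *)
Lemma energy_derive (dom : R -> Prop) (x t : R -> R) (c s : R) :
  generating_curve dom x t -> interior dom s -> rot_curvature x t s = c ->
  is_derive (energy c x t) s 0.
Proof.
intros G Hs Hc.
destruct (speed_rad_ang _ _ _ _ G Hs) as [Hx [HD [Ex _]]].
destruct (rad_ang_equations dom x t s G Hs) as [_ Ea]; rewrite Hc in Ea.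
pose proof (is_derive_x dom x t G s Hs) as Hdx.
pose proof (is_derive_ang dom x t G s Hs) as Hda.
apply (is_derive_ext (fun s => c / 2 * x s ^ 2 - x s * ang x t s)).
{ intros u; symmetry; apply energy_ang. }
auto_derive; [repeat split; eexists; eassumption|].
eta_Derive; rewrite Ex, Ea; field; lra.
Qed.

(** Along the horizontal lift, x^2 solves w'' + c^2 w = 2 + 2 c E, so that
    x^2 - k / c^2 and -2 x rad / c rotate with angular velocity c. The function
    x rad - c t has the derivative of a horizontal arc length: this gives the
    arc length, and with it t, without any quadrature. *)
Lemma profile_of_constant_curvature (dom : R -> Prop) (x t : R -> R) (c : R) :
  c <> 0 -> generating_curve dom x t ->
  (forall s, interior dom s -> rot_curvature x t s = c) ->
  exists sig k r, profile c dom x t sig k r.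
Proof.
intros Hc G H.
destruct (gc_dom _ _ _ G) as [HD [s0 H0]].
pose proof (interior_convex dom HD) as HI.
set (E := energy c x t s0).
assert (HE : forall s, interior dom s -> x s * ang x t s = c / 2 * x s ^ 2 - E).
{ intros s Hs.
  pose proof (constant_of_derive_0 (interior dom) (energy c x t) HI
    (fun u Hu => energy_derive dom x t c u G Hu (H u Hu)) s s0 Hs H0) as Es.
  fold E in Es; rewrite energy_ang in Es; lra. }
set (k := 2 * c * E + 2).
set (g := fun s => x s * rad x t s).
assert (Hg2 : forall s, interior dom s ->
  g s ^ 2 = x s ^ 2 - (c / 2 * x s ^ 2 - E) ^ 2).
{ intros s Hs; unfold g; rewrite <- HE by auto.
  destruct (speed_rad_ang _ _ _ _ G Hs) as [_ [_ [_ [_ E1]]]].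
  transitivity (x s ^ 2 * (rad x t s ^ 2 + ang x t s ^ 2) - (x s * ang x t s) ^ 2);
    [ring|rewrite E1; ring]. }
assert (Hgd : forall s, interior dom s ->
  is_derive g s ((1 - c * (x s * ang x t s)) * (speed x t s / x s))).
{ intros s Hs.
  destruct (speed_rad_ang _ _ _ _ G Hs) as [Hx [_ [Ex [_ E1]]]].
  destruct (rad_ang_equations dom x t s G Hs) as [Er _]; rewrite H in Er by auto.
  pose proof (is_derive_x dom x t G s Hs) as Hdx.
  pose proof (is_derive_rad dom x t G s Hs) as Hdr.
  unfold g; auto_derive; [repeat split; eexists; eassumption|].
  rewrite <- E1 at 3; eta_Derive; rewrite Ex, Er; field; lra. }
set (sig0 := fun s => g s - c * t s).
assert (Hsd : forall s, interior dom s ->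
  is_derive sig0 s (speed x t s / x s)).
{ intros s Hs.
  destruct (speed_rad_ang _ _ _ _ G Hs) as [Hx [_ [_ [Et _]]]].
  pose proof (Hgd s Hs) as Hg.
  pose proof (is_derive_t dom x t G s Hs) as Ht.
  unfold sig0; auto_derive; [repeat split; eexists; eassumption|].
  eta_Derive; rewrite (is_derive_unique _ _ _ Hg), Et; field; lra. }
set (P := fun s => x s ^ 2 - k / c ^ 2).
set (Q := fun s => - 2 / c * g s).
assert (HP : forall s, interior dom s ->
  is_derive P s (- c * Q s * (speed x t s / x s))).
{ intros s Hs.
  destruct (speed_rad_ang _ _ _ _ G Hs) as [Hx [_ [Ex _]]].
  pose proof (is_derive_x dom x t G s Hs) as Hdx.
  unfold P; auto_derive; [repeat split; eexists; eassumption|].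
  eta_Derive; rewrite Ex; unfold Q, g; field; lra. }
assert (HQ : forall s, interior dom s ->
  is_derive Q s (c * P s * (speed x t s / x s))).
{ intros s Hs.
  destruct (speed_rad_ang _ _ _ _ G Hs) as [Hx _].
  pose proof (Hgd s Hs) as Hg.
  unfold Q; auto_derive; [repeat split; eexists; eassumption|].
  eta_Derive; rewrite (is_derive_unique _ _ _ Hg), HE by auto.
  unfold P, k; field; lra. }
assert (HPQ : forall s, interior dom s ->
  P s ^ 2 + Q s ^ 2 = 4 * (k - 1) / c ^ 4).
{ intros s Hs; unfold P, Q.
  transitivity ((x s ^ 2 - k / c ^ 2) ^ 2 + 4 / c ^ 2 * g s ^ 2); [field; auto|].
  rewrite Hg2 by auto; unfold k; field; auto. }
assert (Hc2 : 0 < c ^ 2) by (apply pow2_gt_0; auto).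
assert (Hk : 1 <= k).
{ pose proof (HPQ s0 H0) as F.
  assert (F' : c ^ 2 * c ^ 2 * (P s0 ^ 2 + Q s0 ^ 2) = 4 * (k - 1))
    by (rewrite F; field; auto).
  pose proof (pow2_ge_0 (P s0)); pose proof (pow2_ge_0 (Q s0)).
  assert (0 <= c ^ 2 * c ^ 2 * (P s0 ^ 2 + Q s0 ^ 2)); [|lra].
  apply Rmult_le_pos; [|lra]; apply Rmult_le_pos; lra. }
set (r := 2 / c ^ 2 * sqrt (k - 1)).
assert (Hr : 0 <= r).
{ apply Rmult_le_pos; [left; apply Rdiv_lt_0_compat; lra|apply sqrt_pos]. }
assert (Hr2 : r ^ 2 = 4 * (k - 1) / c ^ 4).
{ unfold r; transitivity (4 / c ^ 4 * (sqrt (k - 1) * sqrt (k - 1)));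
    [field; auto|rewrite sqrt_sqrt by lra; field; auto]. }
(* The components of (P, Q) in axes rotated by c sig0 are constant. *)
assert (HC : forall s, interior dom s ->
  is_derive (fun s => P s * cos (c * sig0 s) + Q s * sin (c * sig0 s)) s 0).
{ intros s Hs; pose proof (HP s Hs) as HPs; pose proof (HQ s Hs) as HQs.
  pose proof (Hsd s Hs) as Hss.
  auto_derive; [repeat split; eexists; eassumption|].
  eta_Derive; rewrite (is_derive_unique _ _ _ HPs), (is_derive_unique _ _ _ HQs),
    (is_derive_unique _ _ _ Hss); ring. }
assert (HS : forall s, interior dom s ->
  is_derive (fun s => Q s * cos (c * sig0 s) - P s * sin (c * sig0 s)) s 0).
{ intros s Hs; pose proof (HP s Hs) as HPs; pose proof (HQ s Hs) as HQs.
  pose proof (Hsd s Hs) as Hss.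
  auto_derive; [repeat split; eexists; eassumption|].
  eta_Derive; rewrite (is_derive_unique _ _ _ HPs), (is_derive_unique _ _ _ HQs),
    (is_derive_unique _ _ _ Hss); ring. }
assert (Hrot : forall S C p q : R, S * S + C * C = 1 ->
  p = C * (p * C + q * S) - S * (q * C - p * S) /\
  q = S * (p * C + q * S) + C * (q * C - p * S)).
{ intros S C p q Hsc; split.
  - transitivity (p * (S * S + C * C)); [rewrite Hsc|]; ring.
  - transitivity (q * (S * S + C * C)); [rewrite Hsc|]; ring. }
destruct (polar_coordinates r (P s0 * cos (c * sig0 s0) + Q s0 * sin (c * sig0 s0))
  (Q s0 * cos (c * sig0 s0) - P s0 * sin (c * sig0 s0))) as [b [Hb1 Hb2]]; auto.
{ rewrite Hr2, <- (HPQ s0 H0).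
  pose proof (sin2_cos2 (c * sig0 s0)) as Hsc; unfold Rsqr in Hsc.
  transitivity ((P s0 ^ 2 + Q s0 ^ 2) * (sin (c * sig0 s0) * sin (c * sig0 s0)
    + cos (c * sig0 s0) * cos (c * sig0 s0))); [ring|rewrite Hsc; ring]. }
assert (HPQs : forall s, interior dom s ->
  P s = r * cos (c * (sig0 s + b / c)) /\ Q s = r * sin (c * (sig0 s + b / c))).
{ intros s Hs.
  pose proof (constant_of_derive_0 _ _ HI HC s s0 Hs H0) as E1; cbv beta in E1.
  pose proof (constant_of_derive_0 _ _ HI HS s s0 Hs H0) as E2; cbv beta in E2.
  rewrite Hb1 in E1; rewrite Hb2 in E2.
  pose proof (sin2_cos2 (c * sig0 s)) as Hsc; unfold Rsqr in Hsc.
  destruct (Hrot _ _ (P s) (Q s) Hsc) as [F1 F2].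
  rewrite E1, E2 in F1, F2.
  replace (c * (sig0 s + b / c)) with (c * sig0 s + b) by (field; auto).
  rewrite cos_plus, sin_plus; split; [rewrite F1|rewrite F2]; ring. }
(* So far everything holds on the interior. At an end of dom, x' may have no
   limit, but g^2 is a continuous function of x, and so g extends. *)
assert (Hgc : forall s, interior dom s -> continuous g s).
{ intros s Hs; apply (ex_derive_continuous (V := R_NormedModule)).
  eexists; apply Hgd; auto. }
destruct (continuous_extension dom g (gc_dom _ _ _ G) Hgc) as [gg [Hgg Egg]].
{ apply (limit_of_square_limit dom g
    (fun s => x s ^ 2 - (c / 2 * x s ^ 2 - E) ^ 2)); auto.
  - exact (gc_dom _ _ _ G).
  - apply (continuous_on_comp dom x (fun y => y ^ 2 - (c / 2 * y ^ 2 - E) ^ 2));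
      [exact (gc_contx _ _ _ G)|].
    intros y; apply (ex_derive_continuous (V := R_NormedModule)); auto_derive; auto. }
set (sig := fun s => gg s + (- c * t s + b / c)).
assert (Hsig : continuous_on dom sig).
{ apply continuous_on_plus; auto.
  apply (continuous_on_comp dom t (fun y => - c * y + b / c));
    [exact (gc_contt _ _ _ G)|].
  intros y; apply (ex_derive_continuous (V := R_NormedModule)); auto_derive; auto. }
assert (Esig : forall s, interior dom s -> sig s = sig0 s + b / c).
{ intros s Hs; unfold sig, sig0; rewrite Egg by auto; ring. }
exists sig, k, r; split; [|split; [|split; [|split]]]; auto.
- split; auto.
  destruct (exists_horizontal_lift dom x t G) as [th Hth].
  exists th; split; auto; intros s Hs.
  rewrite (lift_velocity_norm dom x t th s G Hth Hs).
  apply is_derive_ext_loc with (fun s => sig0 s + b / c).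
  + apply filter_imp with (2 := locally_interior dom s Hs).
    intros u Hu; symmetry; auto.
  + pose proof (Hsd s Hs) as Hss.
    auto_derive; [eexists; eassumption|].
    eta_Derive; rewrite (is_derive_unique _ _ _ Hss); ring.
- apply continuous_on_eq; [exact (gc_dom _ _ _ G)| | |].
  + apply (continuous_on_comp dom x (fun y => y ^ 2)); [exact (gc_contx _ _ _ G)|].
    intros y; apply (ex_derive_continuous (V := R_NormedModule)); auto_derive; auto.
  + apply (continuous_on_comp dom sig (fun y => k / c ^ 2 + r * cos (c * y))); auto.
    intros y; apply (ex_derive_continuous (V := R_NormedModule)); auto_derive; auto.
  + intros s Hs; rewrite Esig by auto.
    rewrite <- (proj1 (HPQs s Hs)); unfold P; ring.
- exists (b / c ^ 2).
  apply continuous_on_eq; [exact (gc_dom _ _ _ G)|exact (gc_contt _ _ _ G)| |].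
  + apply (continuous_on_comp dom sig
      (fun y => - y / c - r / 2 * sin (c * y) + b / c ^ 2)); auto.
    intros y; apply (ex_derive_continuous (V := R_NormedModule)); auto_derive; auto.
  + intros s Hs; rewrite Esig by auto.
    replace (r / 2 * sin (c * (sig0 s + b / c)))
      with (r * sin (c * (sig0 s + b / c)) / 2) by field.
    rewrite <- (proj2 (HPQs s Hs)); unfold Q, sig0; field; auto.
Qed.

(** * The profile curves *)

(** Differentiating the formulas for x^2 and t with respect to the horizontal
    arc length, for which (x', t') is (rad, - x ang). *)
Lemma profile_rad_ang (dom : R -> Prop) (x t sig : R -> R) (c k r : R) :
  c <> 0 -> generating_curve dom x t -> profile c dom x t sig k r ->
  forall s, interior dom s ->
  is_derive sig s (speed x t s / x s) /\
  x s * rad x t s = - (c * r / 2) * sin (c * sig s) /\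
  x s * ang x t s = / c + c * r / 2 * cos (c * sig s).
Proof.
intros Hc G [Hsig [Hk [Hr [Hx2 [t0 Ht]]]]] s Hs.
destruct (horizontal_arclength_derive dom x t sig G Hsig) as [_ [_ Hd]].
specialize (Hd s Hs).
destruct (speed_rad_ang _ _ _ _ G Hs) as [Hx [HD [Ex [Et _]]]].
pose proof (is_derive_x dom x t G s Hs) as Hdx.
pose proof (is_derive_t dom x t G s Hs) as Hdt.
assert (HDx : speed x t s / x s <> 0).
{ apply Rgt_not_eq, Rdiv_lt_0_compat; auto. }
split; [auto|split].
- assert (F : 2 * x s * Derive x s = - (c * r * sin (c * sig s)) * (speed x t s / x s)).
  { rewrite <- (is_derive_unique (fun u => x u ^ 2) s (2 * x s * Derive x s))
      by (auto_derive; [eexists; eassumption|eta_Derive; ring]).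
    rewrite (Derive_ext_loc _ (fun u => k / c ^ 2 + r * cos (c * sig u))).
    - apply is_derive_unique; auto_derive; [eexists; eassumption|].
      eta_Derive; rewrite (is_derive_unique _ _ _ Hd); ring.
    - apply filter_imp with (2 := locally_interior dom s Hs).
      intros u Hu; apply Hx2, interior_subset; auto. }
  rewrite Ex in F.
  apply Rmult_eq_reg_r with (speed x t s / x s); auto.
  transitivity (2 * x s * (rad x t s * speed x t s / x s) / 2); [field; lra|].
  rewrite F; field; lra.
- assert (F : Derive t s = (- / c - c * r / 2 * cos (c * sig s)) * (speed x t s / x s)).
  { rewrite (Derive_ext_loc _ (fun u => - sig u / c - r / 2 * sin (c * sig u) + t0)).
    - apply is_derive_unique; auto_derive; [repeat split; eexists; eassumption|].
      eta_Derive; rewrite (is_derive_unique _ _ _ Hd); field; split; lra.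
    - apply filter_imp with (2 := locally_interior dom s Hs).
      intros u Hu; apply Ht, interior_subset; auto. }
  rewrite Et in F.
  apply Rmult_eq_reg_r with (speed x t s / x s); auto.
  transitivity (- (- ang x t s * speed x t s)); [field; lra|].
  rewrite F; field; split; lra.
Qed.

Lemma profile_amplitude (dom : R -> Prop) (x t sig : R -> R) (c k r : R) :
  c <> 0 -> profile c dom x t sig k r -> r ^ 2 = 4 * (k - 1) / c ^ 4.
Proof.
intros Hc [_ [Hk [-> _]]].
transitivity (4 / c ^ 4 * (sqrt (k - 1) * sqrt (k - 1)));
  [field; auto|rewrite sqrt_sqrt by lra; field; auto].
Qed.

Lemma profile_energy (dom : R -> Prop) (x t sig : R -> R) (c k r : R) :
  c <> 0 -> generating_curve dom x t -> profile c dom x t sig k r ->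
  forall s, interior dom s -> energy c x t s = (k - 2) / (2 * c).
Proof.
intros Hc G HP s Hs; rewrite energy_ang.
destruct (profile_rad_ang dom x t sig c k r Hc G HP s Hs) as [_ [_ Ea]].
destruct HP as [_ [_ [_ [Hx2 _]]]].
rewrite Ea, (Hx2 s (interior_subset _ _ Hs)); field; auto.
Qed.

(** H is computed from the products x rad and x ang, whose derivatives are
    explicit: x^2 H comes out as c (k / c^2 + r cos (c sig)), also at the points
    where x' = 0 and the energy says nothing about H. *)
Lemma profile_curvature (dom : R -> Prop) (x t sig : R -> R) (c k r : R) :
  c <> 0 -> generating_curve dom x t -> profile c dom x t sig k r ->
  forall s, interior dom s -> rot_curvature x t s = c.
Proof.
intros Hc G HP s Hs.
pose proof (profile_amplitude dom x t sig c k r Hc HP) as Hr2.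
pose proof (profile_rad_ang dom x t sig c k r Hc G HP) as F.
destruct (F s Hs) as [Hd [Er Ea]].
destruct (speed_rad_ang _ _ _ _ G Hs) as [Hx [HD [Ex _]]].
pose proof (is_derive_x dom x t G s Hs) as Hdx.
pose proof (is_derive_rad dom x t G s Hs) as Hdr.
pose proof (is_derive_ang dom x t G s Hs) as Hda.
assert (Fr : Derive x s * rad x t s + x s * Derive (rad x t) s =
  - (c * r / 2) * c * cos (c * sig s) * (speed x t s / x s)).
{ rewrite <- (is_derive_unique (fun u => x u * rad x t u) s
    (Derive x s * rad x t s + x s * Derive (rad x t) s))
    by (auto_derive; [repeat split; eexists; eassumption|eta_Derive; ring]).
  rewrite (Derive_ext_loc _ (fun u => - (c * r / 2) * sin (c * sig u))).
  - apply is_derive_unique; auto_derive; [eexists; eassumption|].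
    eta_Derive; rewrite (is_derive_unique _ _ _ Hd); ring.
  - apply filter_imp with (2 := locally_interior dom s Hs).
    intros u Hu; apply F; auto. }
assert (Fa : Derive x s * ang x t s + x s * Derive (ang x t) s =
  - (c * r / 2) * c * sin (c * sig s) * (speed x t s / x s)).
{ rewrite <- (is_derive_unique (fun u => x u * ang x t u) s
    (Derive x s * ang x t s + x s * Derive (ang x t) s))
    by (auto_derive; [repeat split; eexists; eassumption|eta_Derive; ring]).
  rewrite (Derive_ext_loc _ (fun u => / c + c * r / 2 * cos (c * sig u))).
  - apply is_derive_unique; auto_derive; [eexists; eassumption|].
    eta_Derive; rewrite (is_derive_unique _ _ _ Hd); ring.
  - apply filter_imp with (2 := locally_interior dom s Hs).
    intros u Hu; apply F; auto. }
assert (Hx2 : x s ^ 2 = k / c ^ 2 + r * cos (c * sig s)).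
{ apply HP, interior_subset; auto. }
pose proof (sin2_cos2 (c * sig s)) as Hsc; unfold Rsqr in Hsc.
unfold rot_curvature.
apply Rmult_eq_reg_l with (x s ^ 2); [|nra].
set (X := x s) in *; set (D := speed x t s) in *.
set (u := rad x t s) in *; set (v := ang x t s) in *.
set (u' := Derive (rad x t) s) in *; set (v' := Derive (ang x t) s) in *.
set (S := sin (c * sig s)) in *; set (C := cos (c * sig s)) in *.
transitivity ((X * u * (Derive x s * v + X * v')
  - X * v * (Derive x s * u + X * u')) * (X / D) + X * v); [field; lra|].
rewrite Fr, Fa, Er, Ea, Hx2.
transitivity (c ^ 3 * r ^ 2 / 4 * (S * S + C * C) + c * r * C + / c);
  [field; lra|rewrite Hsc, Hr2; field; auto].
Qed.

Lemma interval_image (D : R -> Prop) (f : R -> R) :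
  is_interval D -> continuous_on D f ->
  (exists a b, D a /\ D b /\ f a < f b) ->
  is_interval (fun z => exists s, D s /\ z = f s).
Proof.
intros HD Hf Hab.
assert (HC : convex (fun z => exists s, D s /\ z = f s)).
{ intros z1 z2 z [a [Ha Ea]] [b [Hb Eb]] Hz; subst z1 z2.
  destruct (Req_dec z (f a)) as [|Hza]; [exists a; auto|].
  destruct (Req_dec z (f b)) as [|Hzb]; [exists b; auto|].
  (* At an end of D, f is only continuous from one side. Composing it with the
     path h, which stays between a and b, gives a function continuous
     everywhere. *)
  set (cl := fun u => Rmin 1 (Rmax 0 u)).
  assert (Hcl : forall u, 0 <= cl u <= 1).
  { intros u; unfold cl, Rmin, Rmax.
    destruct (Rle_dec 0 u); destruct (Rle_dec 1 _); lra. }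
  assert (Hclc : forall u u', Rabs (cl u - cl u') <= Rabs (u - u')).
  { intros u u'; unfold cl, Rmin, Rmax.
    repeat destruct (Rle_dec _ _); unfold Rabs;
      repeat destruct (Rcase_abs _); lra. }
  set (h := fun u => a + cl u * (b - a)).
  assert (Hh : forall u, D (h u)).
  { intros u; specialize (Hcl u); destruct (Rle_dec a b).
    - apply (proj1 HD) with a b; auto; unfold h; split; nra.
    - apply (proj1 HD) with b a; auto; unfold h; split; nra. }
  assert (Hfh : forall u, continuity_pt (fun u => f (h u) - z) u).
  { intros u; apply continuity_pt_filterlim.
    apply (filterlim_locally (F := locally u)); intros eps.
    destruct (continuous_on_eps D f (h u) Hf (Hh u) eps) as [d Hd].
    set (m := Rabs (b - a) + 1).
    assert (Hm : 0 < m) by (unfold m; pose proof (Rabs_pos (b - a)); lra).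
    assert (Hdm : 0 < d / m) by (apply Rdiv_lt_0_compat; auto; apply cond_pos).
    exists (mkposreal _ Hdm); intros y Hy.
    change (Rabs (y - u) < d / m) in Hy.
    change (Rabs (f (h y) - z - (f (h u) - z)) < eps).
    replace (f (h y) - z - (f (h u) - z)) with (f (h y) - f (h u)) by ring.
    apply Hd; auto.
    replace (h y - h u) with ((cl y - cl u) * (b - a)) by (unfold h; ring).
    rewrite Rabs_mult; specialize (Hclc y u).
    apply Rle_lt_trans with (Rabs (y - u) * m).
    - apply Rmult_le_compat; try apply Rabs_pos; auto; unfold m; lra.
    - apply Rlt_le_trans with (d / m * m);
        [apply Rmult_lt_compat_r; auto|right; field; lra]. }
  assert (h0 : h 0 = a).
  { unfold h, cl; rewrite Rmax_left, Rmin_right by lra; ring. }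
  assert (h1 : h 1 = b).
  { unfold h, cl; rewrite Rmax_right, Rmin_left by lra; ring. }
  destruct (IVT_interv (fun u => f (h u) - z) 0 1) as [u [_ Hu]];
    [auto|lra|rewrite h0; lra|rewrite h1; lra|].
  exists (h u); split; auto; lra. }
split; [exact HC|].
destruct Hab as [a [b [Ha [Hb Hlt]]]].
exists ((f a + f b) / 2).
assert (Hd : 0 < (f b - f a) / 2) by lra.
exists (mkposreal _ Hd); intros z Hz; unfold disc in Hz; simpl in Hz.
apply Rabs_def2 in Hz.
apply HC with (f a) (f b); [exists a; auto|exists b; auto|lra].
Qed.

(** If r = 0 then k = 1 and x is the constant 1 / |c|, so t' = +-1 and the
    heights of the points form an interval with interior points. *)
Lemma profile_cylinder (dom : R -> Prop) (x t sig : R -> R) (c k r : R) :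
  c <> 0 -> generating_curve dom x t -> profile c dom x t sig k r ->
  r = 0 -> is_cylinder (rot_points dom x t).
Proof.
intros Hc G HP Hr0.
pose proof (profile_amplitude dom x t sig c k r Hc HP) as Hr2.
pose proof (profile_rad_ang dom x t sig c k r Hc G HP) as F.
destruct HP as [_ [_ [_ [Hx2 _]]]].
assert (Hk : k = 1).
{ assert (E : c ^ 4 * r ^ 2 = 4 * (k - 1)) by (rewrite Hr2; field; auto).
  rewrite Hr0 in E; lra. }
assert (Hrho : 0 < / Rabs c) by (apply Rinv_0_lt_compat, Rabs_pos_lt; auto).
assert (Hx : forall s, dom s -> x s = / Rabs c).
{ intros s Hs; pose proof (gc_nonneg _ _ _ G s Hs) as H0.
  specialize (Hx2 s Hs); rewrite Hk, Hr0 in Hx2.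
  assert (E : (/ Rabs c) ^ 2 = x s ^ 2).
  { rewrite Hx2, pow_inv, pow2_abs; field; auto. }
  nra. }
exists (/ Rabs c), (fun z => exists s, dom s /\ z = t s).
destruct (gc_dom _ _ _ G) as [HD [s0 [d0 H0]]].
split; [auto|split].
- apply interval_image; [exact (gc_dom _ _ _ G)|exact (gc_contt _ _ _ G)|].
  assert (Hs1 : interior dom (s0 + d0 / 2)).
  { assert (Hd : 0 < d0 / 2) by (pose proof (cond_pos d0); lra).
    exists (mkposreal _ Hd); intros y Hy; apply H0; unfold disc in *.
    simpl in Hy; apply Rabs_def2 in Hy; apply Rabs_def1; lra. }
  assert (Hs0 : interior dom s0) by (exists d0; exact H0).
  pose proof (cond_pos d0) as Hd.
  destruct (mean_value (interior dom) t (Derive t) (interior_convex dom HD)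
    (is_derive_t dom x t G) s0 (s0 + d0 / 2) Hs0 Hs1) as [m [Hm E]].
  (* x is constant, so t' = +-1. *)
  assert (Hne : Derive t m <> 0).
  { destruct (speed_rad_ang _ _ _ _ G Hm) as [Hxm [HDm [_ [Et E1]]]].
    destruct (F m Hm) as [_ [Er _]]; rewrite Hr0 in Er.
    assert (Hr : rad x t m = 0) by nra.
    rewrite Hr in E1; rewrite Et; nra. }
  apply interior_subset in Hs0; apply interior_subset in Hs1.
  destruct (Rtotal_order (t s0) (t (s0 + d0 / 2))) as [Hlt|[Heq|Hgt]].
  + exists s0, (s0 + d0 / 2); auto.
  + exfalso; apply Hne.
    assert (E' : Derive t m * (d0 / 2) = 0) by lra.
    apply Rmult_integral in E'; lra.
  + exists (s0 + d0 / 2), s0; auto.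
- intros P; split.
  + intros [p [Hp ->]]; unfold rot_surface, px, py, pz; cbn [fst snd].
    split; [|exists (fst p); auto].
    rewrite (Hx _ Hp).
    pose proof (sin2_cos2 (snd p)) as Hsc; unfold Rsqr in Hsc.
    transitivity ((/ Rabs c) ^ 2 * (sin (snd p) * sin (snd p)
      + cos (snd p) * cos (snd p))); [ring|rewrite Hsc; ring].
  + intros [Exy [s [Hs Ez]]].
    destruct (polar_coordinates (/ Rabs c) (px P) (py P)) as [th [E1 E2]];
      [lra|auto|].
    exists (s, th); split; auto.
    destruct P as [[a b] z]; unfold rot_surface, px, py, pz in *; cbn [fst snd] in *.
    rewrite (Hx _ Hs), E1, E2, Ez; reflexivity.
Qed.

(** * Normal coordinates *)

Lemma ex_derive_n_linear (a v : R) (n : nat) :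
  ex_derive_n (fun v => a * v) n v.
Proof.
assert (Ho : open (fun _ : R => True)) by apply open_true.
apply (ex_derive_n_of_Dn (fun _ => True)); auto.
destruct n as [|n]; [exact Logic.I|].
apply Dn_intro with (fun _ => a); auto.
- intros s _; auto_derive; auto; ring.
- apply Dn_const; auto.
Qed.

Lemma dir_affine_in_second (F : R -> R) (k d : R) (p w : plane) :
  is_derive F (fst p) d ->
  dir (fun q => F (fst q) + k * snd q) p w = fst w * d + snd w * k.
Proof.
intros HF; unfold dir, d1, d2; cbn [fst snd].
rewrite (is_derive_unique (fun u : R => F u + k * snd p) (fst p) d)
  by (auto_derive; [eexists; eassumption|eta_Derive;
      rewrite (is_derive_unique _ _ _ HF); ring]).
rewrite (is_derive_unique (fun v : R => F (fst p) + k * v) (snd p) k)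
  by (auto_derive; auto; ring).
reflexivity.
Qed.

Lemma dir_scal (f : plane -> R) (p w : plane) (a : R) :
  dir f p (scal a w) = a * dir f p w.
Proof.
destruct w as [w1 w2]; unfold dir, scal; simpl; unfold prod_scal, scal; simpl.
unfold mult; simpl; ring.
Qed.

Lemma dX_scal (X : plane -> H1) (p w : plane) (a : R) :
  dX X p (scal a w) = scal a (dX X p w).
Proof. unfold dX; rewrite !dir_scal; reflexivity. Qed.

Lemma derive_pos_inj (I : R -> Prop) (f df : R -> R) : convex I ->
  (forall s, I s -> is_derive f s (df s)) -> (forall s, I s -> 0 < df s) ->
  forall a b, I a -> I b -> f a = f b -> a = b.
Proof.
intros HI Hf Hp a b Ha Hb E.
destruct (mean_value I f df HI Hf a b Ha Hb) as [m [Hm F]].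
specialize (Hp m Hm).
assert (F' : df m * (b - a) = 0) by lra.
apply Rmult_integral in F'; lra.
Qed.

(** The characteristic curves are the level curves of
    psi = theta - (theta along the lift), so s = sig - E psi and
    th = - c^2 r psi / 2 are compatible coordinates; the coefficients of psi are
    those for which a and b have the normal form. The phase is then c sig. *)
Lemma profile_normal_coordinates (dom : R -> Prop) (x t sig : R -> R)
    (e : plane -> plane) (c k r E : R) :
  c <> 0 -> generating_curve dom x t -> rot_characteristic_field dom x t e ->
  profile c dom x t sig k r -> k = 2 * c * E + 2 -> r <> 0 ->
  exists (W : plane -> Prop) (s th : plane -> R),
    normal_coordinates c (rot_domain dom) (rot_surface x t) e W s th
      (fun v => - (2 * E * v) / (c * r))
      (fun _ => - (2 * c * E + 2) / (c ^ 2 * r)) /\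
    forall p alpha, rot_domain dom p -> alpha_at (rot_surface x t) e p alpha ->
      alpha <> 0 -> W p.
Proof.
intros Hc G He HP Hk Hr.
pose proof (profile_rad_ang dom x t sig c k r Hc G HP) as F.
destruct HP as [Hsig [_ [_ [Hx2 _]]]].
destruct (horizontal_arclength_derive dom x t sig G Hsig) as [th0 [Hl _]].
pose proof (proj1 (horizontal_lift_iff dom x t th0 G) Hl) as Hth.
assert (HI : open (interior dom)) by exact (locally_interior dom).
pose proof (interior_convex dom (proj1 (gc_dom _ _ _ G))) as HIc.
set (K := c ^ 2 * r / 2).
assert (HK : K <> 0).
{ assert (H2 : 0 < c ^ 2) by (apply pow2_gt_0; auto).
  unfold K; intros H; apply Rmult_integral in H; destruct H as [H|H]; [|lra].
  apply Rmult_integral in H; destruct H; lra. }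
set (Fs := fun u => sig u + E * th0 u).
set (Ft := fun u => K * th0 u).
set (W := fun p : plane => rot_domain dom p /\ sin (c * sig (fst p)) <> 0).
assert (HFs : forall u, interior dom u ->
  is_derive Fs u (speed x t u / x u + E * (- Derive t u / x u ^ 2))).
{ intros u Hu; destruct (F u Hu) as [Hd _]; pose proof (Hth u Hu) as Ht.
  unfold Fs; auto_derive; [repeat split; eexists; eassumption|eta_Derive].
  rewrite (is_derive_unique _ _ _ Hd), (is_derive_unique _ _ _ Ht); ring. }
assert (HFt : forall u, interior dom u ->
  is_derive Ft u (K * (- Derive t u / x u ^ 2))).
{ intros u Hu; pose proof (Hth u Hu) as Ht.
  unfold Ft; auto_derive; [repeat split; eexists; eassumption|eta_Derive].
  rewrite (is_derive_unique _ _ _ Ht); ring. }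
assert (HDt : forall n, Dn n (interior dom) (fun u => - Derive t u / x u ^ 2)).
{ intros n; apply Dn_ext with (fun u => -1 * (Derive t u * (/ x u * / x u))); auto.
  - intros u Hu; pose proof (gc_immersed _ _ _ G u Hu); field; auto.
  - apply Dn_mult; auto; [apply Dn_const; auto|].
    apply Dn_mult; auto; [apply (Dn_Dt dom x t G)|].
    apply Dn_mult; auto; apply (Dn_inv_x dom x t G). }
assert (HFsn : forall n, Dn n (interior dom) Fs).
{ intros [|n]; [exact Logic.I|].
  apply Dn_intro with (1 := HI) (2 := HFs).
  apply Dn_plus; auto.
  - apply Dn_mult; auto; [apply (Dn_speed dom x t G)|apply (Dn_inv_x dom x t G)].
  - apply Dn_mult; auto; apply Dn_const; auto. }
assert (HFtn : forall n, Dn n (interior dom) Ft).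
{ intros [|n]; [exact Logic.I|].
  apply Dn_intro with (1 := HI) (2 := HFt).
  apply Dn_mult; auto; apply Dn_const; auto. }
assert (HW : open W).
{ intros p [Hp Hs].
  assert (Hc0 : continuous (fun q : plane => sin (c * sig (fst q))) p).
  { apply (continuous_comp (fun q : plane => fst q) (fun u => sin (c * sig u)));
      [apply continuous_fst|].
    apply (ex_derive_continuous (V := R_NormedModule)).
    destruct (F _ Hp) as [Hd _].
    auto_derive; eexists; eassumption. }
  apply (filter_and (F := locally p)); [apply open_rot_domain; auto|].
  exact (Hc0 (fun z => z <> 0) (open_neq 0 _ Hs)). }
exists W, (fun p : plane => Fs (fst p) + (- E) * snd p),
  (fun p : plane => Ft (fst p) + (- K) * snd p).
split.
- split; [|split].
  + split; [auto|]. split; [|split; [|split; [|split; [|split; [|split]]]]].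
    * intros p [Hp _]; split; auto; apply (rot_surface_regular dom x t G); auto.
    * apply smooth_affine_in_second with (interior dom); auto; intros p [Hp _]; auto.
    * apply smooth_affine_in_second with (interior dom); auto; intros p [Hp _]; auto.
    * intros [p1 p2] [q1 q2] [Hp _] [Hq _]; unfold Fs, Ft; cbn [fst snd].
      intros E1 E2.
      assert (E3 : th0 p1 - p2 = th0 q1 - q2).
      { apply Rmult_eq_reg_l with K; auto; lra. }
      assert (E4 : sig p1 = sig q1).
      { apply Rplus_eq_reg_r with (E * (th0 p1 - p2)); rewrite E3 at 2; lra. }
      assert (E5 : p1 = q1).
      { apply (derive_pos_inj (interior dom) sig (fun u => speed x t u / x u)); auto.
        - intros u Hu; apply F; auto.
        - intros u Hu; destruct (speed_rad_ang _ _ _ _ G Hu) as [Hx [HD _]].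
          apply Rdiv_lt_0_compat; auto. }
      subst q1; f_equal; lra.
    * intros p [Hp _]; cbv beta.
      destruct (speed_rad_ang _ _ _ _ G Hp) as [Hx [HD _]].
      (* The partial derivatives are the derivatives along (1, 0) and (0, 1). *)
      pose proof (dir_affine_in_second Fs (- E) _ p (1, 0) (HFs _ Hp)) as D1.
      pose proof (dir_affine_in_second Fs (- E) _ p (0, 1) (HFs _ Hp)) as D2.
      pose proof (dir_affine_in_second Ft (- K) _ p (1, 0) (HFt _ Hp)) as D3.
      pose proof (dir_affine_in_second Ft (- K) _ p (0, 1) (HFt _ Hp)) as D4.
      unfold dir in D1, D2, D3, D4; cbn [fst snd] in D1, D2, D3, D4.
      rewrite Rmult_1_l, !Rmult_0_l, Rplus_0_r in D1, D3.
      rewrite Rmult_1_l, !Rmult_0_l, Rplus_0_l in D2, D4.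
      rewrite Rmult_1_l, Rplus_0_r in D1, D3.
      rewrite Rmult_1_l, Rplus_0_l in D2, D4.
      rewrite D1, D2, D3, D4.
      intros H; apply HK.
      apply Rmult_eq_reg_r with (speed x t (fst p) / x (fst p));
        [|apply Rgt_not_eq, Rdiv_lt_0_compat; auto].
      lra.
    * intros p [Hp _]; rewrite (dir_affine_in_second _ _ _ _ _ (HFs _ Hp)).
      rewrite (char_field_rot dom x t e p G He Hp); cbn [fst snd].
      destruct (speed_rad_ang _ _ _ _ G Hp) as [Hx [HD [_ [Et _]]]].
      rewrite Et; field; lra.
    * intros p [Hp _]; rewrite (dir_affine_in_second _ _ _ _ _ (HFt _ Hp)).
      rewrite (char_field_rot dom x t e p G He Hp); cbn [fst snd].
      destruct (speed_rad_ang _ _ _ _ G Hp) as [Hx [HD [_ [Et _]]]].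
      rewrite Et; field; lra.
  + intros p n _; split.
    * apply ex_derive_n_ext with (fun v => - (2 * E) / (c * r) * v);
        [intros; field; auto|apply ex_derive_n_linear].
    * destruct n; [exact Logic.I|].
      apply (ex_derive_n_of_Dn (fun _ => True)); auto.
      apply Dn_const; apply open_true.
  + intros p [Hp Hs]; cbv zeta.
    destruct (speed_rad_ang _ _ _ _ G Hp) as [Hx [HD [_ [Et E1]]]].
    destruct (F _ Hp) as [_ [Er Ea]].
    pose proof (Hx2 _ (interior_subset _ _ Hp)) as HX.
    assert (EA : 2 * (c / 2) * (Fs (fst p) + - E * snd p)
      + - (2 * E * (Ft (fst p) + - K * snd p)) / (c * r) = c * sig (fst p)).
    { unfold Fs, Ft, K; field; auto. }
    rewrite EA; clear EA.
    assert (EB : - (2 * c * E + 2) / (c ^ 2 * r) - cos (c * sig (fst p))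
      = - x (fst p) ^ 2 / r).
    { rewrite HX, Hk; field; auto. }
    rewrite EB; clear EB.
    assert (HB : - x (fst p) ^ 2 / r <> 0).
    { intros H; apply Rmult_integral in H; destruct H as [H|H];
        [nra|exact (Rinv_neq_0_compat r Hr H)]. }
    split; [auto|].
    set (alpha := rad x t (fst p) / x (fst p)).
    assert (Hq : 0 < sqrt (1 + alpha ^ 2)).
    { apply sqrt_lt_R0; pose proof (pow2_ge_0 alpha); lra. }
    assert (Ealpha : alpha = c / 2 * (sin (c * sig (fst p)) / (- x (fst p) ^ 2 / r))).
    { unfold alpha; transitivity (x (fst p) * rad x t (fst p) / x (fst p) ^ 2);
        [field; lra|rewrite Er; field; split; lra]. }
    exists alpha, (- (c / 2) / sqrt (1 + alpha ^ 2)),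
      (2 * (c / 2) ^ 2 / (- x (fst p) ^ 2 / r * sqrt (1 + alpha ^ 2))).
    split; [|split; [|split; [|split; [|split]]]]; auto.
    * apply (alpha_at_rot dom x t e p alpha G He Hp); reflexivity.
    * rewrite Ealpha; intros H.
      apply Rmult_integral in H; destruct H as [H|H]; [lra|].
      apply Rmult_integral in H; destruct H as [H|H]; [auto|].
      exact (Rinv_neq_0_compat _ HB H).
    * exists (scal (/ sqrt (1 + alpha ^ 2)) (rot_normal x t (fst p))).
      rewrite dX_scal, !dir_scal.
      rewrite (proj2 (alpha_rot dom x t e p (rot_normal x t (fst p)) alpha G He Hp))
        by (split; reflexivity).
      split; [reflexivity|].
      rewrite (dir_affine_in_second _ _ _ _ _ (HFs _ Hp)).
      rewrite (dir_affine_in_second _ _ _ _ _ (HFt _ Hp)).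
      unfold rot_normal; cbn [fst snd].
      assert (E2 : rad x t (fst p) ^ 2 = 1 - ang x t (fst p) ^ 2) by lra.
      rewrite Et, E2.
      assert (E3 : E = c / 2 * x (fst p) ^ 2 - x (fst p) * ang x t (fst p)).
      { rewrite HX, Ea, Hk; field; auto. }
      split; [rewrite E3|unfold K]; field; repeat split; lra.
- intros p alpha Hp Ha Hn; split; auto; intros Hs; apply Hn.
  apply (alpha_at_rot dom x t e p alpha G He Hp) in Ha.
  destruct (F _ Hp) as [_ [Er _]].
  destruct (speed_rad_ang _ _ _ _ G Hp) as [Hx _].
  rewrite Hs, Rmult_0_r in Er.
  rewrite Ha; transitivity (x (fst p) * rad x t (fst p) / x (fst p) ^ 2);
    [field; lra|rewrite Er; field; lra].
Qed.

(** The intermediate value theorem along a path in W. *)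
Lemma path_connected_value (W : plane -> Prop) (f : plane -> R) (p q : plane)
    (v : R) :
  path_connected W -> (forall m, W m -> continuous f m) -> W p -> W q ->
  (f p - v) * (f q - v) <= 0 -> exists m, W m /\ f m = v.
Proof.
intros HW Hf Hp Hq H; apply NNPP; intros Hn.
destruct (HW p q Hp Hq) as [g [Hg [E0 [E1 HgW]]]].
assert (Hpos : 0 < (f (g 0) - v) * (f (g 1) - v)).
{ apply (no_sign_change (fun u => 0 <= u <= 1) (fun u => f (g u) - v));
    try lra.
  - intros a b u Ha Hb Hu; lra.
  - intros u Hu.
    apply (continuous_minus (V := R_NormedModule) (fun u => f (g u)) (fun _ => v));
      [|apply continuous_const].
    apply (continuous_comp g f); [apply Hg|apply Hf, HgW; auto].
  - intros u Hu Ev; apply Hn; exists (g u); split; [auto|lra]. }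
rewrite E0, E1 in Hpos; lra.
Qed.

Lemma smooth_continuous (W : plane -> Prop) (f : plane -> R) (p : plane) :
  smooth W f -> W p -> continuous f p.
Proof. intros H; apply (H O). Qed.

Lemma smooth_d1 (W : plane -> Prop) (f : plane -> R) (p : plane) :
  smooth W f -> W p -> is_derive (fun u => f (u, snd p)) (fst p) (d1 f p).
Proof. intros H Hp; apply Derive_correct, (H 1%nat); auto. Qed.

Lemma smooth_d2 (W : plane -> Prop) (f : plane -> R) (p : plane) :
  smooth W f -> W p -> is_derive (fun v => f (fst p, v)) (snd p) (d2 f p).
Proof. intros H Hp; apply Derive_correct, (H 1%nat); auto. Qed.

(** * Uniqueness of the invariants *)

Section Uniqueness.
Context (dom : R -> Prop) (x t sig : R -> R) (e : plane -> plane)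
  (c k r E : R) (Hc : c <> 0) (G : generating_curve dom x t)
  (He : rot_characteristic_field dom x t e)
  (HP : profile c dom x t sig k r) (Hk : k = 2 * c * E + 2) (Hr : r <> 0)
  (W : plane -> Prop) (s th : plane -> R) (zeta1 zeta2 : R -> R)
  (HN : normal_coordinates c (rot_domain dom) (rot_surface x t) e W s th
          zeta1 zeta2).

(** The phase of the normal form, and its denominator. *)
Let A (p : plane) : R := c * s p + zeta1 (th p).
Let B (p : plane) : R := zeta2 (th p) - cos (A p).

Lemma normal_domain (p : plane) : W p -> rot_domain dom p.
Proof. intros Hp; destruct HN as [[_ [H _]] _]; apply H; auto. Qed.

(** The normal form prescribes derivatives along a unit vector; along
    alpha e_2 + T itself the factors sqrt (1 + alpha^2) disappear. *)
Lemma normal_form_equations (p : plane) : W p ->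
  B p <> 0 /\
  rad x t (fst p) / x (fst p) = c / 2 * (sin (A p) / B p) /\
  dir s p (rot_normal x t (fst p)) = - (c / 2) /\
  dir th p (rot_normal x t (fst p)) = c ^ 2 / (2 * B p).
Proof.
intros Hp; pose proof (normal_domain p Hp) as HpU.
destruct HN as [_ [_ H]]; specialize (H p Hp); cbv zeta in H.
assert (EA : 2 * (c / 2) * s p + zeta1 (th p) = A p) by (unfold A; field).
rewrite EA in H; clear EA; fold (B p) in H.
destruct H as [HB [alpha [a [b [Ha [_ [[w [Hw [Ewa Ewb]]] [Ea [Eb1 Eb2]]]]]]]]].
apply (alpha_at_rot dom x t e p alpha G He HpU) in Ha.
assert (Hq : 0 < sqrt (1 + alpha ^ 2)).
{ apply sqrt_lt_R0; pose proof (pow2_ge_0 alpha); lra. }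
assert (Ew : w = scal (/ sqrt (1 + alpha ^ 2)) (rot_normal x t (fst p))).
{ apply (dX_rot_surface_inj dom x t p); auto.
  rewrite dX_scal, Hw; f_equal; symmetry.
  apply (alpha_rot dom x t e p _ alpha G He HpU); auto. }
rewrite Ew, dir_scal in Ewa, Ewb.
set (q := sqrt (1 + alpha ^ 2)) in *.
split; [auto|split; [rewrite <- Ha; exact Ea|split]].
- apply Rmult_eq_reg_l with (/ q); [|apply Rinv_neq_0_compat; lra].
  rewrite Ewa, Eb1; field; lra.
- apply Rmult_eq_reg_l with (/ q); [|apply Rinv_neq_0_compat; lra].
  rewrite Ewb, Eb2; field; split; [auto|lra].
Qed.

Lemma zeta_derivatives (p : plane) : W p ->
  is_derive zeta1 (th p) (Derive zeta1 (th p)) /\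
  is_derive zeta2 (th p) (Derive zeta2 (th p)).
Proof.
intros Hp; destruct HN as [_ [H _]].
destruct (H p 1%nat Hp) as [H1 H2].
split; apply Derive_correct; [exact H1|exact H2].
Qed.

Lemma A_partials (p : plane) : W p ->
  is_derive (fun u : R => A (u, snd p)) (fst p)
    (c * d1 s p + Derive zeta1 (th p) * d1 th p) /\
  is_derive (fun v : R => A (fst p, v)) (snd p)
    (c * d2 s p + Derive zeta1 (th p) * d2 th p).
Proof.
intros Hp; destruct HN as [[_ [_ [Hs [Ht _]]]] _].
pose proof (smooth_d1 W s p Hs Hp) as S1; pose proof (smooth_d2 W s p Hs Hp) as S2.
pose proof (smooth_d1 W th p Ht Hp) as T1; pose proof (smooth_d2 W th p Ht Hp) as T2.
destruct (zeta_derivatives p Hp) as [Z1 _].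
destruct p as [p1 p2]; cbn [fst snd] in *.
unfold A; split.
- apply (is_derive_plus (V := R_NormedModule)
    (fun u => c * s (u, p2)) (fun u => zeta1 (th (u, p2)))).
  + apply (is_derive_scal (fun u => s (u, p2))); exact S1.
  + rewrite Rmult_comm; apply (is_derive_comp zeta1 (fun u => th (u, p2))); auto.
- apply (is_derive_plus (V := R_NormedModule)
    (fun v => c * s (p1, v)) (fun v => zeta1 (th (p1, v)))).
  + apply (is_derive_scal (fun v => s (p1, v))); exact S2.
  + rewrite Rmult_comm; apply (is_derive_comp zeta1 (fun v => th (p1, v))); auto.
Qed.

Lemma B_partials (p : plane) : W p ->
  is_derive (fun u : R => B (u, snd p)) (fst p)
    (Derive zeta2 (th p) * d1 th p
     + sin (A p) * (c * d1 s p + Derive zeta1 (th p) * d1 th p)) /\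
  is_derive (fun v : R => B (fst p, v)) (snd p)
    (Derive zeta2 (th p) * d2 th p
     + sin (A p) * (c * d2 s p + Derive zeta1 (th p) * d2 th p)).
Proof.
intros Hp; destruct (A_partials p Hp) as [A1 A2].
destruct HN as [[_ [_ [_ [Ht _]]]] _].
pose proof (smooth_d1 W th p Ht Hp) as T1; pose proof (smooth_d2 W th p Ht Hp) as T2.
destruct (zeta_derivatives p Hp) as [_ Z2].
assert (HC : forall y, is_derive (fun y => - cos y) y (sin y))
  by (intros y; auto_derive; auto; ring).
destruct p as [p1 p2]; cbn [fst snd] in *.
unfold B; split.
- apply (is_derive_ext (fun u => zeta2 (th (u, p2)) + - cos (A (u, p2))));
    [reflexivity|].
  apply (is_derive_plus (V := R_NormedModule)
    (fun u => zeta2 (th (u, p2))) (fun u => - cos (A (u, p2)))).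
  + rewrite Rmult_comm; apply (is_derive_comp zeta2 (fun u => th (u, p2))); auto.
  + rewrite Rmult_comm; apply (is_derive_comp (fun y => - cos y) (fun u => A (u, p2)));
      [apply HC|exact A1].
- apply (is_derive_ext (fun v => zeta2 (th (p1, v)) + - cos (A (p1, v))));
    [reflexivity|].
  apply (is_derive_plus (V := R_NormedModule)
    (fun v => zeta2 (th (p1, v))) (fun v => - cos (A (p1, v)))).
  + rewrite Rmult_comm; apply (is_derive_comp zeta2 (fun v => th (p1, v))); auto.
  + rewrite Rmult_comm; apply (is_derive_comp (fun y => - cos y) (fun v => A (p1, v)));
      [apply HC|exact A2].
Qed.

Lemma sin_over_B (p : plane) : W p ->
  sin (A p) / B p = - r * sin (c * sig (fst p)) / x (fst p) ^ 2.
Proof.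
intros Hp; pose proof (normal_domain p Hp) as HpU.
destruct (normal_form_equations p Hp) as [HB [Ea _]].
destruct (profile_rad_ang dom x t sig c k r Hc G HP _ HpU) as [_ [Er _]].
destruct (speed_rad_ang _ _ _ _ G HpU) as [Hx _].
transitivity (2 / c * (x (fst p) * rad x t (fst p)) / x (fst p) ^ 2).
- transitivity (2 / c * (c / 2 * (sin (A p) / B p))); [field; auto|].
  rewrite <- Ea; field; split; lra.
- rewrite Er; field; split; lra.
Qed.

(** A second relation comes from differentiating the first along e_1, where
    both A and c sig have derivative c and zeta2 is constant. *)
Lemma cos_over_B (p : plane) : W p ->
  cos (A p) / B p = - r * cos (c * sig (fst p)) / x (fst p) ^ 2.
Proof.
intros Hp; pose proof (normal_domain p Hp) as HpU.
destruct (normal_form_equations p Hp) as [HB _].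
pose proof (sin_over_B p Hp) as ES.
assert (HW : open W) by apply HN.
assert (ED : dir (fun q => sin (A q) / B q) p (e p) =
  dir (fun q => - r * sin (c * sig (fst q)) / x (fst q) ^ 2) p (e p)).
{ apply (dir_ext W); auto; apply sin_over_B. }
assert (E1 : dir s p (e p) = 1 /\ dir th p (e p) = 0) by (split; apply HN; auto).
destruct E1 as [E1 E0].
assert (EL : dir (fun q => sin (A q) / B q) p (e p) =
  c * (cos (A p) * B p - sin (A p) ^ 2) / B p ^ 2).
{ destruct (A_partials p Hp) as [A1 A2]; destruct (B_partials p Hp) as [B1 B2].
  assert (Q : forall (f g : R -> R) u f' g', is_derive f u f' -> is_derive g u g' ->
    g u <> 0 -> Derive (fun u => sin (f u) / g u) u =
    (cos (f u) * f' * g u - sin (f u) * g') / g u ^ 2).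
  { intros f g u f' g' Hf Hg H0; apply is_derive_unique.
    auto_derive; [repeat split; try (eexists; eassumption); auto|].
    eta_Derive; rewrite (is_derive_unique _ _ _ Hf), (is_derive_unique _ _ _ Hg).
    field; auto. }
  change (dir (fun q => sin (A q) / B q) p (e p)) with
    (fst (e p) * Derive (fun u : R => sin (A (u, snd p)) / B (u, snd p)) (fst p)
     + snd (e p) * Derive (fun v : R => sin (A (fst p, v)) / B (fst p, v)) (snd p)).
  assert (HB' : B (fst p, snd p) <> 0) by (destruct p; exact HB).
  pose proof (Q _ _ _ _ _ A1 B1 HB') as Q1; cbv beta in Q1.
  pose proof (Q _ _ _ _ _ A2 B2 HB') as Q2; cbv beta in Q2.
  rewrite Q1, Q2, <- (surjective_pairing p).
  unfold dir in E1, E0.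
  transitivity ((c * (fst (e p) * d1 s p + snd (e p) * d2 s p)
    + Derive zeta1 (th p) * (fst (e p) * d1 th p + snd (e p) * d2 th p))
    * (cos (A p) * B p - sin (A p) ^ 2) / B p ^ 2
    - sin (A p) * Derive zeta2 (th p)
      * (fst (e p) * d1 th p + snd (e p) * d2 th p) / B p ^ 2);
    [field; auto|].
  rewrite E1, E0; field; auto. }
destruct (profile_rad_ang dom x t sig c k r Hc G HP _ HpU) as [Hd [Er _]].
destruct (speed_rad_ang _ _ _ _ G HpU) as [Hx [HD [Ex _]]].
assert (ER : dir (fun q => - r * sin (c * sig (fst q)) / x (fst q) ^ 2) p (e p) =
  - r * c * (cos (c * sig (fst p)) * x (fst p) ^ 2
    + r * sin (c * sig (fst p)) ^ 2) / x (fst p) ^ 4).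
{ pose proof (is_derive_x dom x t G _ HpU) as Hdx.
  unfold dir, d1, d2; cbn [fst snd]; rewrite Derive_const.
  rewrite (is_derive_unique (fun u : R => - r * sin (c * sig u) / x u ^ 2) (fst p)
    (- r * (c * cos (c * sig (fst p)) * (speed x t (fst p) / x (fst p)) * x (fst p) ^ 2
       - sin (c * sig (fst p)) * (2 * (x (fst p) * rad x t (fst p))
         * (speed x t (fst p) / x (fst p)))) / x (fst p) ^ 4)).
  - rewrite Er, (char_field_rot dom x t e p G He HpU); cbn [fst snd].
    field; split; lra.
  - auto_derive.
    + repeat split; try (eexists; eassumption).
      simpl; intros H; nra.
    + eta_Derive; rewrite (is_derive_unique _ _ _ Hd), Ex; field; lra. }
rewrite EL, ER in ED.
assert (ED' : cos (A p) / B p - (sin (A p) / B p) ^ 2 =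
  - r * (cos (c * sig (fst p)) * x (fst p) ^ 2
    + r * sin (c * sig (fst p)) ^ 2) / x (fst p) ^ 4).
{ apply Rmult_eq_reg_l with c; auto.
  transitivity (c * (cos (A p) * B p - sin (A p) ^ 2) / B p ^ 2); [field; auto|].
  rewrite ED; field; lra. }
rewrite ES in ED'.
transitivity (cos (A p) / B p - (- r * sin (c * sig (fst p)) / x (fst p) ^ 2) ^ 2
  + (- r * sin (c * sig (fst p)) / x (fst p) ^ 2) ^ 2); [ring|].
rewrite ED'; field; lra.
Qed.

(** By the two relations above, the pairs (sin, cos) of A and of c sig are
    proportional, and the factor is a sign: it accounts for the symmetry
    (th, zeta1, zeta2) -> (- th, zeta1 + pi, - zeta2) of the normal form. *)
Definition normal_sign (p : plane) : R := - r * B p / x (fst p) ^ 2.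

Lemma normal_sign_spec (p : plane) : W p ->
  let eps := normal_sign p in
  eps ^ 2 = 1 /\
  sin (A p) = eps * sin (c * sig (fst p)) /\
  cos (A p) = eps * cos (c * sig (fst p)) /\
  B p = - eps * x (fst p) ^ 2 / r /\
  zeta2 (th p) = - eps * k / (c ^ 2 * r).
Proof.
intros Hp eps; pose proof (normal_domain p Hp) as HpU.
destruct (normal_form_equations p Hp) as [HB _].
destruct (speed_rad_ang _ _ _ _ G HpU) as [Hx _].
assert (ES : sin (A p) = eps * sin (c * sig (fst p))).
{ transitivity (sin (A p) / B p * B p); [field; auto|].
  rewrite sin_over_B by auto; unfold eps, normal_sign; field; lra. }
assert (EC : cos (A p) = eps * cos (c * sig (fst p))).
{ transitivity (cos (A p) / B p * B p); [field; auto|].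
  rewrite cos_over_B by auto; unfold eps, normal_sign; field; lra. }
assert (EB : B p = - eps * x (fst p) ^ 2 / r).
{ unfold eps, normal_sign; field; split; lra. }
split; [|split; [|split; [|split]]]; auto.
- pose proof (sin2_cos2 (A p)) as H1; pose proof (sin2_cos2 (c * sig (fst p))) as H2.
  unfold Rsqr in H1, H2; rewrite ES, EC in H1.
  transitivity (eps ^ 2 * (sin (c * sig (fst p)) * sin (c * sig (fst p))
    + cos (c * sig (fst p)) * cos (c * sig (fst p)))); [rewrite H2; ring|].
  rewrite <- H1; ring.
- transitivity (B p + cos (A p)); [unfold B; ring|].
  rewrite EB, EC.
  destruct HP as [_ [_ [_ [Hx2 _]]]].
  rewrite (Hx2 _ (interior_subset _ _ HpU)); field; auto.
Qed.

(** sin (A - c sig) vanishes on W, so A and c sig have the same derivatives;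
    along alpha e_2 + T this determines zeta1'. *)
Lemma zeta1_derivative (p : plane) : W p ->
  Derive zeta1 (th p) = normal_sign p * (- (2 * E) / (c * r)).
Proof.
intros Hp; pose proof (normal_domain p Hp) as HpU.
destruct (normal_sign_spec p Hp) as [He2 [ES [EC [EB _]]]].
set (eps := normal_sign p) in *.
destruct (normal_form_equations p Hp) as [HB [_ [Ns Nt]]].
destruct (profile_rad_ang dom x t sig c k r Hc G HP _ HpU) as [Hd [_ Ea]].
destruct (speed_rad_ang _ _ _ _ G HpU) as [Hx [HD _]].
destruct (A_partials p Hp) as [A1 A2].
assert (HW : open W) by apply HN.
set (f := fun q : plane =>
  sin (A q) * cos (c * sig (fst q)) - cos (A q) * sin (c * sig (fst q))).
assert (Hf : forall q, W q -> f q = (fun _ => 0) q).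
{ intros q Hq; destruct (normal_sign_spec q Hq) as [_ [ES' [EC' _]]].
  unfold f; rewrite ES', EC'; ring. }
assert (Heps : eps <> 0) by nra.
pose proof (sin2_cos2 (c * sig (fst p))) as Hsc; unfold Rsqr in Hsc.
assert (E1 : c * d1 s p + Derive zeta1 (th p) * d1 th p
  = c * (speed x t (fst p) / x (fst p))).
{ pose proof (d1_ext W f _ p HW Hp Hf) as H.
  unfold d1 at 2 in H; rewrite Derive_const in H.
  unfold d1, f in H; cbn [fst snd] in H.
  assert (Q : forall (g h : R -> R) u g' h', is_derive g u g' -> is_derive h u h' ->
    Derive (fun u => sin (g u) * cos (c * h u) - cos (g u) * sin (c * h u)) u =
    (sin (g u) * sin (c * h u) + cos (g u) * cos (c * h u)) * (g' - c * h')).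
  { intros g h u g' h' Hg Hh; apply is_derive_unique.
    auto_derive; [repeat split; eexists; eassumption|].
    eta_Derive; rewrite (is_derive_unique _ _ _ Hg), (is_derive_unique _ _ _ Hh); ring. }
  pose proof (Q _ _ _ _ _ A1 Hd) as Q1; cbv beta in Q1.
  rewrite Q1, <- (surjective_pairing p), ES, EC in H.
  assert (H' : eps * (c * d1 s p + Derive zeta1 (th p) * d1 th p
    - c * (speed x t (fst p) / x (fst p))) = 0).
  { rewrite <- H, <- (Rmult_1_r eps) at 1; rewrite <- Hsc; ring. }
  apply Rmult_integral in H'; destruct H'; [tauto|lra]. }
assert (E2 : c * d2 s p + Derive zeta1 (th p) * d2 th p = 0).
{ pose proof (d2_ext W f _ p HW Hp Hf) as H.
  unfold d2 at 2 in H; rewrite Derive_const in H.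
  unfold d2, f in H; cbn [fst snd] in H.
  assert (Q : forall (g : R -> R) a b u g', is_derive g u g' ->
    Derive (fun u => sin (g u) * a - cos (g u) * b) u =
    (sin (g u) * b + cos (g u) * a) * g').
  { intros g a b u g' Hg; apply is_derive_unique.
    auto_derive; [repeat split; eexists; eassumption|].
    eta_Derive; rewrite (is_derive_unique _ _ _ Hg); ring. }
  pose proof (Q _ (cos (c * sig (fst p))) (sin (c * sig (fst p))) _ _ A2) as Q2.
  cbv beta in Q2; rewrite Q2, <- (surjective_pairing p), ES, EC in H.
  assert (H' : eps * (c * d2 s p + Derive zeta1 (th p) * d2 th p) = 0).
  { rewrite <- H, <- (Rmult_1_r eps) at 1; rewrite <- Hsc; ring. }
  apply Rmult_integral in H'; destruct H'; [tauto|lra]. }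
assert (EN : c * dir s p (rot_normal x t (fst p))
  + Derive zeta1 (th p) * dir th p (rot_normal x t (fst p))
  = - c * ang x t (fst p) / x (fst p)).
{ unfold dir.
  transitivity (fst (rot_normal x t (fst p))
      * (c * d1 s p + Derive zeta1 (th p) * d1 th p)
    + snd (rot_normal x t (fst p))
      * (c * d2 s p + Derive zeta1 (th p) * d2 th p)); [ring|].
  rewrite E1, E2; unfold rot_normal; cbn [fst snd]; field; split; lra. }
rewrite Ns, Nt in EN.
assert (EE : E = c / 2 * x (fst p) ^ 2 - x (fst p) * ang x t (fst p)).
{ destruct HP as [_ [_ [_ [Hx2 _]]]].
  rewrite Ea, (Hx2 _ (interior_subset _ _ HpU)), Hk; field; auto. }
transitivity (2 * B p / c ^ 2 * (Derive zeta1 (th p) * (c ^ 2 / (2 * B p))));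
  [field; auto|].
replace (Derive zeta1 (th p) * (c ^ 2 / (2 * B p)))
  with (- c * ang x t (fst p) / x (fst p) + c * (c / 2)) by lra.
rewrite EB, EE; field; repeat split; lra.
Qed.

(** B does not vanish on W, so it keeps its sign, which is opposite to that of
    normal_sign when r > 0 and equal to it when r < 0. *)
Lemma normal_sign_constant (p q : plane) : path_connected W -> W p -> W q ->
  normal_sign p = normal_sign q.
Proof.
intros HWc Hp Hq.
assert (HBc : forall m, W m -> continuous B m).
{ intros m Hm; destruct HN as [[_ [_ [Hs [Ht _]]]] _].
  pose proof (smooth_continuous W s m Hs Hm) as Cs.
  pose proof (smooth_continuous W th m Ht Hm) as Ct.
  destruct (zeta_derivatives m Hm) as [Z1 Z2].
  assert (Z : forall (zeta : R -> R) (l : R), is_derive zeta (th m) l ->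
    continuous (fun m => zeta (th m)) m).
  { intros zeta l Hz; apply (continuous_comp th zeta); auto.
    apply (ex_derive_continuous (V := R_NormedModule)); eexists; exact Hz. }
  apply (continuous_minus (V := R_NormedModule)
    (fun m => zeta2 (th m)) (fun m => cos (A m))); [exact (Z _ _ Z2)|].
  apply (continuous_comp A cos); [|apply continuous_cos].
  apply (continuous_plus (V := R_NormedModule)
    (fun m => c * s m) (fun m => zeta1 (th m))); [|exact (Z _ _ Z1)].
  apply (continuous_mult (K := R_AbsRing) (fun _ => c) s); auto.
  apply continuous_const. }
assert (Hpos : 0 < B p * B q).
{ apply Rnot_le_lt; intros Hle.
  destruct (path_connected_value W B p q 0) as [m [Hm Em]]; auto; [lra|].
  destruct (normal_form_equations m Hm) as [H _]; auto. }
destruct (normal_sign_spec p Hp) as [Sp [_ [_ [Bp _]]]].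
destruct (normal_sign_spec q Hq) as [Sq [_ [_ [Bq _]]]].
destruct (speed_rad_ang _ _ _ _ G (normal_domain p Hp)) as [Hxp _].
destruct (speed_rad_ang _ _ _ _ G (normal_domain q Hq)) as [Hxq _].
rewrite Bp, Bq in Hpos.
set (a := normal_sign p) in *; set (b := normal_sign q) in *.
assert (Hab : 0 < a * b).
{ apply Rmult_lt_reg_r with (x (fst p) ^ 2 * x (fst q) ^ 2 / r ^ 2).
  - apply Rdiv_lt_0_compat; [|apply pow2_gt_0; auto].
    apply Rmult_lt_0_compat; apply pow_lt; auto.
  - rewrite Rmult_0_l; apply Rlt_le_trans with (1 := Hpos).
    right; field; auto. }
assert (H : (a - b) * (a + b) = 0) by lra.
apply Rmult_integral in H; destruct H; nra.
Qed.

(** The set th(W) is an interval, on which zeta1' is constant. *)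
Lemma normal_invariants (HWc : path_connected W) :
  exists eps C : R, (eps = 1 \/ eps = -1) /\
    forall p, W p ->
      zeta1 (th p) = eps * (- (2 * E * th p) / (c * r)) + C /\
      zeta2 (th p) = eps * (- (2 * c * E + 2) / (c ^ 2 * r)).
Proof.
destruct (classic (exists p0, W p0)) as [[p0 H0]|Hn].
2: { exists 1, 0; split; [auto|]; intros p Hp; exfalso; eauto. }
set (eps := normal_sign p0).
exists eps, (zeta1 (th p0) - eps * (- (2 * E * th p0) / (c * r))); split.
{ destruct (normal_sign_spec p0 H0) as [H _]; fold eps in H.
  assert (F : (eps - 1) * (eps + 1) = 0) by lra.
  apply Rmult_integral in F; destruct F; [left|right]; lra. }
intros p Hp; split.
- set (V := fun v => exists m, W m /\ th m = v).
  assert (HV : convex V).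
  { intros a b v [ma [Ha Ea]] [mb [Hb Eb]] Hv.
    apply (path_connected_value W th ma mb v); auto.
    - intros m Hm; apply smooth_continuous with W; auto; apply HN.
    - rewrite Ea, Eb; nra. }
  destruct (mean_value V zeta1 (fun _ => eps * (- (2 * E) / (c * r))) HV)
    with (a := th p0) (b := th p) as [m [_ Em]].
  + intros v [m [Hm Ev]]; rewrite <- Ev.
    unfold eps; rewrite (normal_sign_constant p0 m HWc H0 Hm).
    rewrite <- (zeta1_derivative m Hm); apply zeta_derivatives; auto.
  + exists p0; auto.
  + exists p; auto.
  + replace (zeta1 (th p)) with (zeta1 (th p) - zeta1 (th p0) + zeta1 (th p0))
      by ring.
    rewrite Em; field; auto.
- destruct (normal_sign_spec p Hp) as [_ [_ [_ [_ Ez]]]].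
  rewrite Ez, <- (normal_sign_constant p0 p HWc H0 Hp), Hk; fold eps.
  field; auto.
Qed.

End Uniqueness.

Theorem theorem1 :
  forall (c : R) (dom : R -> Prop) (x t : R -> R) (e1 : plane -> plane),
  c <> 0 ->
  generating_curve dom x t ->
  rot_characteristic_field dom x t e1 ->
  let U := rot_domain dom in
  let X := rot_surface x t in
  (constant_pmean_curvature U X e1 c <->
   exists (sig : R -> R) (k r : R), profile c dom x t sig k r) /\
  (forall (sig : R -> R) (k r : R), profile c dom x t sig k r ->
   exists E : R,
     (forall s, interior dom s -> energy c x t s = E) /\
     k = 2 * c * E + 2 /\
     (r = 0 -> is_cylinder (rot_points dom x t)) /\
     (r <> 0 ->
        (exists (W : plane -> Prop) (s th : plane -> R),
           normal_coordinates c U X e1 W s th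
             (fun v => - (2 * E * v) / (c * r))
             (fun _ => - (2 * c * E + 2) / (c ^ 2 * r)) /\
           forall p alpha, U p -> alpha_at X e1 p alpha -> alpha <> 0 -> W p) /\
        (forall (W : plane -> Prop) (s th : plane -> R) (zeta1 zeta2 : R -> R),
           path_connected W ->
           normal_coordinates c U X e1 W s th zeta1 zeta2 ->
           exists eps C : R, (eps = 1 \/ eps = -1) /\
             forall p, W p ->
               zeta1 (th p) = eps * (- (2 * E * th p) / (c * r)) + C /\
               zeta2 (th p) = eps * (- (2 * c * E + 2) / (c ^ 2 * r))))).
Proof.
intros c dom x t e1 Hc G He U X; split; [split|].
- intros H; apply profile_of_constant_curvature; auto.
  intros s Hs.
  apply (pmean_curvature_rot dom x t e1 (s, 0) c G He Hs).
  apply H; [exact Hs|exact (rot_surface_regular dom x t G (s, 0) Hs)].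
- intros [sig [k [r HP]]] p Hp _.
  apply (pmean_curvature_rot dom x t e1 p c G He Hp).
  exact (profile_curvature dom x t sig c k r Hc G HP _ Hp).
- intros sig k r HP.
  assert (Hk : k = 2 * c * ((k - 2) / (2 * c)) + 2) by (field; auto).
  exists ((k - 2) / (2 * c)); split; [|split; [|split]].
  + exact (profile_energy dom x t sig c k r Hc G HP).
  + exact Hk.
  + exact (profile_cylinder dom x t sig c k r Hc G HP).
  + intros Hr; split.
    * exact (profile_normal_coordinates dom x t sig e1 c k r _ Hc G He HP Hk Hr).
    * intros W s th zeta1 zeta2 HWc HN.
      exact (normal_invariants dom x t sig e1 c k r _ Hc G He HP Hk Hr
        W s th zeta1 zeta2 HN HWc).
Qed.
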